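(* Let $q\ge 3$. The group $\tilde H_{2q}(\mathsf{M}_{5q+4};\mathbb{Z})$ contains an element of order $5$ if and only if there is a cycle $\gamma$ of type $[1,0]\wedge[3,1]\wedge[5,2]^q$ in $\tilde C_{2q}(\mathsf{M}_{5q+4};\mathbb{Z})$ whose homology class has order $5$ in $\tilde H_{2q}(\mathsf{M}_{5q+4};\mathbb{Z})$. If this is the case, then $\tilde H_{2q+u}(\mathsf{M}_{5q+4+2u};\mathbb{Z})$ contains an element of order $5$ for every $u\ge 0$.
   Context: For a finite set $S$, $\mathsf{M}[S]$ is the matching complex of the complete graph on $S$ (vertices: edges $ab=\{a,b\}$ of the complete graph on $S$; faces: matchings), and $\mathsf{M}_n=\mathsf{M}[[n]]$. $\tilde C$, $\tilde H$ denote reduced simplicial chains and homology; an oriented simplex is written $e_0\wedge\cdots\wedge e_d$. For chains $c$, $c'$ supported on matchings of disjoint vertex sets, $c\wedge c'$ is the bilinear extension of $(e_0\wedge\cdots\wedge e_a)\wedge(f_0\wedge\cdots\wedge f_b)=e_0\wedge\cdots\wedge e_a\wedge f_0\wedge\cdots\wedge f_b$. A cycle $z\in\tilde C_{d-1}(\mathsf{M}_n)$ with $d=d_1+\cdots+d_s$ has type $[n_1,d_1]\wedge\cdots\wedge[n_s,d_s]$ if there is a partition $[n]=S_1\cup\cdots\cup S_s$ with $|S_i|=n_i$ and cycles $z_i\in\tilde C_{d_i-1}(\mathsf{M}[S_i])$ with $z=z_1\wedge\cdots\wedge z_s$; here $\tilde C_{-1}$ is spanned by the empty simplex, and $[n,d]^q$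 denotes $q$ copies of $[n,d]$ joined by $\wedge$. *)

(* Defs.v *)
From HB Require Import structures.
From mathcomp Require Import all_boot all_order all_algebra.
From mathcomp Require Import boolp.
Set Implicit Arguments.
Unset Strict Implicit.
Unset Printing Implicit Defensive.
Import Order.TTheory GRing.Theory Num.Theory.
Local Open Scope ring_scope.

Section SimplicialHomology.
Variable V : finType.

(* All chains, of every degree, on the full simplex with vertex set V.  The
   coefficient at A : {set V} is that of the oriented simplex on A whose vertices
   are listed in the order of [enum A], that is, of increasing [enum_rank]. *)
Definition chain : Type := {ffun {set V} -> int}.
HB.instance Definition _ := GRing.Zmodule.on chain.

Fixpoint inversions (s : seq V) : nat :=
  if s is x :: s' then
    (count (fun y => enum_rank y < enum_rank x)%N s' + inversions s')%N
  else 0%N.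

(* e_0 /\ ... /\ e_d for s = [:: e_0; ...; e_d]; it is 0 if a vertex is repeated,
   and [osimplex [::]] is the empty simplex, which spans degree -1. *)
Definition osimplex (s : seq V) : chain :=
  [ffun A => if uniq s && (A == [set x in s]) then (-1) ^+ inversions s else 0].

(* Bilinear extension of concatenation of oriented simplices. *)
Definition wedge (c c' : chain) : chain :=
  \sum_(A : {set V}) \sum_(B : {set V})
    osimplex (enum A ++ enum B) *~ (c A * c' B).

(* Since [rem x] deletes x, this is the usual alternating sum of facets; the
   boundary of a vertex is the empty simplex (augmentation). *)
Definition boundary (c : chain) : chain :=
  \sum_(A : {set V}) \sum_(x in A)
    osimplex (rem x (enum A)) *~ ((-1) ^+ index x (enum A) * c A).

Lemma boundary_is_zmod_morphism : zmod_morphism boundary.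
Proof.
move=> c c'; rewrite /boundary -sumrB; apply: eq_bigr => A _.
rewrite -sumrB; apply: eq_bigr => x _.
by rewrite !ffunE mulrBr mulrzBr.
Qed.
HB.instance Definition _ :=
  GRing.isZmodMorphism.Build chain chain boundary boundary_is_zmod_morphism.

Variables (K : {set {set V}}) (i : int).

Definition in_degree : {pred chain} :=
  [pred c : chain | [forall A, (c A != 0) ==> (A \in K) && (#|A|%:Z == i + 1)]].

Lemma in_degree_zmod_closed : zmod_closed in_degree.
Proof.
split=> [|c c' /forallP hc /forallP hc']; apply/forallP => A.
  by rewrite ffunE eqxx.
rewrite !ffunE; apply/implyP => h.
have [c0|c0] := eqVneq (c A) 0; last exact: implyP (hc A) c0.
by apply: (implyP (hc' A)); move: h; rewrite c0 sub0r oppr_eq0.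
Qed.
HB.instance Definition _ :=
  GRing.isZmodClosed.Build chain in_degree in_degree_zmod_closed.

Definition is_cycle : {pred chain} :=
  [pred c : chain | (c \in in_degree) && (boundary c == 0)].

Lemma is_cycle_zmod_closed : zmod_closed is_cycle.
Proof.
split=> [|c c' /andP[hc /eqP dc] /andP[hc' /eqP dc']].
  by rewrite inE rpred0 raddf0 eqxx.
by rewrite inE rpredB// raddfB /= dc dc' subrr eqxx.
Qed.
HB.instance Definition _ :=
  GRing.isZmodClosed.Build chain is_cycle is_cycle_zmod_closed.

Record cycles : Type := Cycle { cycle_val :> chain; _ : is_cycle cycle_val }.
HB.instance Definition _ := [isSub for cycle_val].
HB.instance Definition _ := [Choice of cycles by <:].
HB.instance Definition _ := [SubChoice_isSubZmodule of cycles by <:].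

End SimplicialHomology.

Section Homology.
Variables (V : finType) (K : {set {set V}}) (i : int).

Definition is_boundary : {pred cycles K i} :=
  fun z => `[< exists2 c, c \in in_degree K (i + 1) & boundary c = z >].

Lemma is_boundary_zmod_closed : zmod_closed is_boundary.
Proof.
split=> [|z z' /asboolP[c hc dc] /asboolP[c' hc' dc']]; apply/asboolP.
  by exists 0; rewrite ?rpred0// raddf0.
by exists (c - c'); rewrite ?rpredB// raddfB /= dc dc'.
Qed.
HB.instance Definition _ :=
  GRing.isZmodClosed.Build (cycles K i) is_boundary is_boundary_zmod_closed.

Definition homology : Type := Quotient.quot is_boundary.
HB.instance Definition _ := GRing.Zmodule.on homology.

Definition homology_class (z : cycles K i) : homology :=
  (\pi_(Quotient.quot is_boundary) z)%qT.

End Homology.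

Definition has_order (G : zmodType) (x : G) (m : nat) : Prop :=
  [/\ (0 < m)%N, x *+ m = 0 & forall k, (0 < k < m)%N -> x *+ k != 0].

(* M[S]: the edges are the 2-subsets of S, so the ambient vertex set of the
   complex is {set T}. *)
Definition matching_complex (T : finType) (S : {set T}) : {set {set {set T}}} :=
  [set A : {set {set T}} |
    trivIset A && [forall e in A, (#|e| == 2) && (e \subset S)]].

Definition matching_complexn (n : nat) : {set {set {set 'I_n}}} :=
  matching_complex [set: 'I_n].

(* z has type [n_1,d_1] /\ ... /\ [n_s,d_s] for ts = [:: (n_1,d_1); ...; (n_s,d_s)].
   The empty simplex is the unit of [wedge]. *)
Definition has_type (n : nat) (ts : seq (nat * nat)) (z : chain {set 'I_n}) : Prop :=
  z \in is_cycle (matching_complexn n) ((\sum_(t <- ts) t.2)%N%:Z - 1) /\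
  exists (S : 'I_(size ts) -> {set 'I_n})
         (y : 'I_(size ts) -> chain {set 'I_n}),
    [/\ \bigcup_j S j = [set: 'I_n],
        forall j k, j != k -> [disjoint S j & S k],
        forall j, #|S j| = (tnth (in_tuple ts) j).1,
        forall j, y j \in is_cycle (matching_complex (S j))
                                   ((tnth (in_tuple ts) j).2%:Z - 1)
      & z = \big[@wedge _/osimplex [::]]_j y j].

(* Main.v *)
(* Write [n_1,d_1] /\ [n_2,d_2] /\ ... for the products of cycles on disjoint vertex sets,
   let n be the number of vertices and r the number of edges of the matchings, and put
   w = 2n - 5r: the factors [1,0], [3,1], [5,2] have w = 2, 1, 0.  Everything is done
   up to multiplication by integers prime to 5.

   Fix two vertices v1, v2.  Comparing a cycle with its links at pairs of edges v1 a, v2 b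
   shows that cycles of weight w are generated by products [3,1] /\ z with z of weight
   w - 1 and by lifts of cycles of weight w + 2 on four vertices less; a cycle
   [1,0] /\ z of the latter kind lifts to [5,2] /\ z.  Together with the relations
   [1,0] /\ [1,0] = 0 and 6 ([3,1] /\ [3,1]) in [1,0] /\ [5,2], an induction on n gives:
   every cycle of weight >= 4 is a boundary, and the cycles of weight 2 and 3 are
   generated by [1,0] /\ [5,2]^q and [1,0] /\ [3,1] /\ [5,2]^q.

   On the other hand 5 ([5,2] /\ [5,2]) lies in [3,1] /\ [7,3], so that
   [1,0] /\ [3,1] /\ [5,2]^2 is torsion.  Hence, as soon as q >= 2, an element of order 5
   forces one of the generators to have order divisible by 5, and a multiple of it has
   order 5.  One factor [5,2] can be taken to be a hexagon, the fundamental cycle of a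
   chessboard complex; enlarging the chessboard keeps the cycle torsion when q >= 3, and
   taking links of the new edges recovers the old cycle, so that 5 still divides its
   order. *)

(* The wedge makes chains into the exterior algebra on the edges, with the boundary and the links as
   contractions; these anticommute, and signs are settled on words of edges instead of sorted sets.
   Working up to certain integers is the parameter [D] of [hull]. The lemmas on small cycles hold
   for any multiplicative [D] containing the constants 2 or 6 that arise; they serve with [coprime5]
   for generation and with [pos_nat] for torsion. The constant 5 of [hex_hex] lies only in
   [pos_nat], so that relation proves torsion without excluding order 5. A cycle of weight 1 has no
   factor [1,0] to offer: the induction records only a factor [3,1], and a second [3,1] then yields
   a free vertex. Products are shown to bound by collecting two free vertices, which can be joined
   by an edge. Hexagons replace pentagons because they belong to the chessboard cycles with k rows
   and k + 1 columns, where the link at a corner lowers k by one; the price is a factor 2. The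
   torsion relation uses up two factors [5,2] and must leave the hexagon intact, since the hexagon
   is what gets enlarged: this accounts for the three factors. *)
From HB Require Import structures.
Require Import Defs.
From mathcomp Require Import all_boot all_order all_algebra.
From mathcomp Require Import boolp zify.
Import Order.TTheory GRing.Theory Num.Theory.
Set Implicit Arguments.
Unset Strict Implicit.
Unset Printing Implicit Defensive.
Local Open Scope ring_scope.

(** * The exterior algebra of chains *)

Section Alternating.
Variables V W : finType.
Implicit Types (s : seq V) (c : chain V) (f : seq V -> chain W).

Definition alternating f :=
  forall s1 x y s2, f (s1 ++ x :: y :: s2) = - f (s1 ++ y :: x :: s2).

Lemma chain_opp_eq0 (c : chain W) : c = - c -> c = 0.
Proof.
move=> h; apply/ffunP => A; rewrite [RHS]ffunE.
have : c A = - c A by rewrite {1}h ffunE.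
by move=> ?; apply/eqP; rewrite -[c A == 0](mulrn_eq0 (c A) 2) mulr2n addr_eq0; apply/eqP.
Qed.

Lemma chainMzE (c : chain W) (k : int) A : (c *~ k) A = c A * k.
Proof.
by rewrite -mulrzz; case: k => n; rewrite /intmul ?ffunE ffunMnE.
Qed.

Lemma alt_move f s1 x t s2 : alternating f ->
  f (s1 ++ x :: t ++ s2) = f (s1 ++ t ++ x :: s2) *~ (-1) ^+ size t.
Proof.
move=> hf; elim: t s1 => [|y t IH] s1 /=; first by rewrite mulr1z.
rewrite hf -cat_rcons IH cat_rcons exprS mulN1r.
by rewrite mulrNz.
Qed.

Lemma alt_nuniq f s : alternating f -> ~~ uniq s -> f s = 0.
Proof.
move=> hf.
suff h s1 : ~~ uniq s -> f (s1 ++ s) = 0 by move/(h [::]).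
elim: s s1 => [//|x s IH] s1 /=; rewrite negb_and negbK => /orP[|us]; last first.
  by rewrite -cat_rcons IH.
case/splitPr => t t'.
have -> : s1 ++ x :: t ++ x :: t' = s1 ++ x :: t ++ (x :: t') by [].
rewrite alt_move // (_ : f _ = 0) ?mul0rz //.
by apply: chain_opp_eq0; rewrite catA; apply: hf.
Qed.

End Alternating.

(** The exponent is chosen before [f]: one sign serves [osimplex] and every other alternating
    function at once, so that it cancels when the two are compared in [ext_osimplex]. *)
Lemma alt_perm (V : finType) (s s' : seq V) : perm_eq s s' ->
  exists b : nat, forall (W : finType) (f : seq V -> chain W), alternating f ->
    f s = f s' *~ (-1) ^+ b.
Proof.
suff h s1 : perm_eq s s' -> exists b : nat,
   forall (W : finType) (f : seq V -> chain W), alternating f ->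
    f (s1 ++ s) = f (s1 ++ s') *~ (-1) ^+ b by move/(h [::]).
elim: s s1 s' => [|x s IH] s1 s' p.
  by exists 0%N => W f hf; move: p; rewrite perm_sym => /perm_nilP ->; rewrite mulr1z.
have: x \in s' by rewrite -(perm_mem p) mem_head.
move=> xs'; case/splitPr: xs' p => t t' p.
have p' : perm_eq s (t ++ t').
  by rewrite -(perm_cons x) (perm_trans p)// -cat1s perm_catCA.
have [b hb] := IH (rcons s1 x) _ p'.
exists (size t + b)%N => W f hf.
rewrite -cat_rcons hb // cat_rcons alt_move // exprD -mulrzA //.
Qed.

Section Osimplex.
Variable V : finType.
Implicit Types (s : seq V) (c : chain V).

Lemma osimplex_val s A :
  osimplex s A = if uniq s && (A == [set x in s]) then (-1) ^+ inversions s else 0.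
Proof. by rewrite ffunE. Qed.

Lemma osimplex_alt : alternating (@osimplex V).
Proof.
move=> s1 x y s2; apply/ffunP => A; rewrite !ffunE.
have p : perm_eq (s1 ++ x :: y :: s2) (s1 ++ y :: x :: s2).
  by rewrite perm_cat2l -cat1s -(cat1s y) perm_catCA.
rewrite (perm_uniq p).
have -> : [set z in s1 ++ x :: y :: s2] = [set z in s1 ++ y :: x :: s2].
  by apply/setP => z; rewrite !inE (perm_mem p).
case: ifP => [/andP[us _]|_]; last by rewrite oppr0.
have nxy : x != y.
  by move: us; rewrite cat_uniq => /and3P[_ _] /= /andP[]; rewrite inE negb_or eq_sym => /andP[].
elim: s1 {p us} => [|z s1 IH] /=.
  have nr : enum_rank x != enum_rank y :> nat.
    by apply: contra nxy => /eqP/val_inj/enum_rank_inj->.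
  case: (ltngtP (enum_rank x) (enum_rank y)) nr => // h _; rewrite ?add0n.
    rewrite add1n !addSn exprS mulN1r addnCA addnA opprK.
    by congr (_ ^+ _); lia.
  by rewrite add1n !addSn exprS mulN1r; congr (- (_ ^+ _)); lia.
rewrite !exprD IH mulrN; congr (- (_ ^+ _ * _)).
rewrite !count_cat /=; lia.
Qed.

Lemma osimplex_nuniq s : ~~ uniq s -> osimplex s = 0.
Proof. exact/alt_nuniq/osimplex_alt. Qed.

Lemma inversions_sorted s :
  sorted ltn [seq nat_of_ord (enum_rank x) | x <- s] -> inversions s = 0%N.
Proof.
elim: s => [//|x s IH] /= h; rewrite IH ?(path_sorted h) // addn0.
apply/eqP; rewrite -leqn0 leqNgt -has_count; apply/hasPn => y ys /=.
have /allP/(_ (nat_of_ord (enum_rank y))) := order_path_min ltn_trans h.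
by move/(_ (map_f _ ys)) => /=; lia.
Qed.

Lemma enum_rank_index x : enum_rank x = index x (enum V) :> nat.
Proof.
rewrite -{2}(nth_enum_rank x x) index_uniq ?enum_uniq // -cardE; exact: ltn_ord.
Qed.

Lemma inversions_enum (A : {set V}) : inversions (enum A) = 0%N.
Proof.
apply: inversions_sorted; rewrite sorted_map.
have -> : enum A = filter (mem A) (enum V) by rewrite {2}/enum_mem filter_predT.
apply: sorted_filter; first by move=> x y z /=; apply: ltn_trans.
rewrite -sorted_map.
have -> : [seq nat_of_ord (enum_rank x) | x <- enum V] = iota 0 (size (enum V)).
  rewrite (eq_map enum_rank_index); case E: (enum V) => [//|x0 s].
  rewrite -E; apply: (@eq_from_nth _ 0%N); rewrite size_map ?size_iota // => i hi.
  by rewrite (nth_map x0) // nth_iota // index_uniq ?enum_uniq.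
exact: iota_ltn_sorted.
Qed.

Lemma osimplex_enum (A : {set V}) : osimplex (enum A) = [ffun B => (B == A)%:R].
Proof.
apply/ffunP => B; rewrite !ffunE enum_uniq inversions_enum expr0 /=.
have -> : [set x in enum A] = A by apply/setP => x; rewrite inE mem_enum.
by case: eqP.
Qed.

(** Linear extension from the basis of sorted words. For alternating [f] the value on any oriented
    simplex is [f] of its word ([ext_osimplex]), so the chosen order of vertices disappears from
    later arguments. *)
Definition ext (W : finType) (f : seq V -> chain W) (c : chain V) : chain W :=
  \sum_(A : {set V}) f (enum A) *~ c A.

Lemma ext_is_zmod_morphism (W : finType) (f : seq V -> chain W) : zmod_morphism (ext f).
Proof.
move=> c c'; rewrite /ext -sumrB; apply: eq_bigr => A _.
by rewrite !ffunE mulrzBr.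
Qed.

HB.instance Definition _ (W : finType) (f : seq V -> chain W) :=
  GRing.isZmodMorphism.Build (chain V) (chain W) (ext f) (ext_is_zmod_morphism f).

Lemma ext_enum (W : finType) (f : seq V -> chain W) (A : {set V}) :
  ext f (osimplex (enum A)) = f (enum A).
Proof.
rewrite /ext (bigD1 A) //= osimplex_enum ffunE eqxx mulr1z big1 ?addr0 // => B nBA.
by rewrite ffunE (negbTE nBA) mulr0z.
Qed.

Lemma osimplex_norm s : uniq s -> exists b : nat,
  osimplex s = osimplex (enum [set x in s]) *~ (-1) ^+ b /\
  forall (W : finType) (f : seq V -> chain W), alternating f ->
    f s = f (enum [set x in s]) *~ (-1) ^+ b.
Proof.
move=> us; have p : perm_eq s (enum [set x in s]).
  by apply: uniq_perm => // [|x]; rewrite ?enum_uniq // mem_enum inE.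
have [b hb] := alt_perm p; exists b; split=> //.
exact/hb/osimplex_alt.
Qed.

Lemma ext_osimplex (W : finType) (f : seq V -> chain W) s :
  alternating f -> ext f (osimplex s) = f s.
Proof.
move=> hf; have [us|nus] := boolP (uniq s); last first.
  by rewrite osimplex_nuniq // raddf0 (alt_nuniq hf).
have [b [-> h]] := osimplex_norm us.
by rewrite raddfMz /= ext_enum (h _ _ hf).
Qed.

Lemma chainE c : c = \sum_(A : {set V}) osimplex (enum A) *~ c A.
Proof.
apply/ffunP => B; rewrite sum_ffunE (bigD1 B) //= big1 => [|A nAB].
  by rewrite chainMzE osimplex_enum ffunE eqxx addr0 mul1r.
by rewrite chainMzE osimplex_enum ffunE eq_sym (negbTE nAB) mul0r.
Qed.

End Osimplex.

(** * The wedge as an associative product *)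

Section Ring.
Variable V : finType.
Implicit Types (s t : seq V) (c : chain V).

(** Additive identities are checked on basis simplices only; the predicate [P] restricts to the
    simplices that occur in [c], for instance those of a fixed degree when a sign depends on it. *)
Lemma eq_zmod_morphism_in (U : zmodType) (f g : chain V -> U) (P : {set V} -> Prop) c :
  zmod_morphism f -> zmod_morphism g ->
  (forall A, P A -> f (osimplex (enum A)) = g (osimplex (enum A))) ->
  (forall A, c A != 0 -> P A) -> f c = g c.
Proof.
move=> hf hg h hc.
pose F : {additive chain V -> U} := HB.pack f (GRing.isZmodMorphism.Build _ _ f hf).
pose G : {additive chain V -> U} := HB.pack g (GRing.isZmodMorphism.Build _ _ g hg).
rewrite -[f]/(F : _ -> _) -[g]/(G : _ -> _) (chainE c) !raddf_sum.
apply: eq_bigr => A _; rewrite !raddfMz.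
by have [->|/hc/h /= ->] := eqVneq (c A) 0; rewrite ?mulr0z.
Qed.

Lemma eq_zmod_morphism (U : zmodType) (f g : chain V -> U) :
  zmod_morphism f -> zmod_morphism g ->
  (forall s, uniq s -> f (osimplex s) = g (osimplex s)) -> f =1 g.
Proof.
move=> hf hg h c; apply: (eq_zmod_morphism_in (P := fun=> True)) => // A _.
exact/h/enum_uniq.
Qed.

Lemma zmod_morphismD (U : zmodType) (f : chain V -> U) :
  zmod_morphism f -> {morph f : x y / x + y}.
Proof.
move=> hf x y.
pose F : {additive chain V -> U} := HB.pack f (GRing.isZmodMorphism.Build _ _ f hf).
exact: (raddfD F).
Qed.

Lemma alternating_ext (U W : finType) (f : seq V -> seq U -> chain W) (c : chain U) :
  (forall t : seq U, alternating (f^~ t)) -> alternating (fun s => ext (f s) c).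
Proof.
move=> hf s1 x y s2; rewrite /ext -sumrN; apply: eq_bigr => A _.
by rewrite -mulNrz (hf (enum A)).
Qed.

Lemma osimplex_cat_altl t : alternating (fun s => osimplex (s ++ t)).
Proof. by move=> s1 x y s2; rewrite -!catA /= osimplex_alt. Qed.

Lemma osimplex_cat_altr s : alternating (fun t => osimplex (s ++ t)).
Proof. by move=> s1 x y s2; rewrite !catA osimplex_alt. Qed.

Lemma wedgeE c c' :
  wedge c c' = ext (fun s => ext (fun t => osimplex (s ++ t)) c') c.
Proof.
apply: eq_bigr => A _; rewrite /ext mulrz_suml; apply: eq_bigr => B _.
by rewrite -mulrzA mulrC.
Qed.

Lemma wedge_osimplex s t : wedge (osimplex s) (osimplex t) = osimplex (s ++ t).
Proof.
rewrite wedgeE ext_osimplex; last exact/alternating_ext/osimplex_cat_altl.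
by rewrite ext_osimplex //; apply: osimplex_cat_altr.
Qed.

Lemma wedge_zmodl c' : zmod_morphism (fun c => wedge c c').
Proof. by move=> c d; rewrite !wedgeE raddfB. Qed.

Lemma wedge_zmodr c : zmod_morphism (wedge c).
Proof.
move=> c' d; rewrite /wedge -sumrB; apply: eq_bigr => A _.
rewrite -sumrB; apply: eq_bigr => B _.
by rewrite !ffunE mulrBr mulrzBr.
Qed.

Lemma wedgeBl c d e : wedge (c - d) e = wedge c e - wedge d e.
Proof. exact: (wedge_zmodl e). Qed.

Lemma wedgeBr c d e : wedge c (d - e) = wedge c d - wedge c e.
Proof. exact: wedge_zmodr. Qed.

Lemma wedgeA : associative (@wedge V).
Proof.
move=> c d e; apply: (eq_zmod_morphism
   (f := fun c => wedge c (wedge d e)) (g := fun c => wedge (wedge c d) e)) c.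
- exact: wedge_zmodl.
- by move=> c c'; rewrite !wedgeBl.
move=> s _; apply: (eq_zmod_morphism
   (f := fun d => wedge (osimplex s) (wedge d e))
   (g := fun d => wedge (wedge (osimplex s) d) e)) d.
- by move=> d d'; rewrite !(wedgeBl, wedgeBr).
- by move=> d d'; rewrite !(wedgeBl, wedgeBr).
move=> t _; apply: (eq_zmod_morphism
   (f := fun e => wedge (osimplex s) (wedge (osimplex t) e))
   (g := fun e => wedge (wedge (osimplex s) (osimplex t)) e)) e.
- by move=> d d'; rewrite !wedgeBr.
- exact: wedge_zmodr.
by move=> u _; rewrite !wedge_osimplex catA.
Qed.

Lemma wedge1c : left_id (osimplex [::]) (@wedge V).
Proof.
move=> c; rewrite wedgeE (ext_osimplex _ (alternating_ext _ osimplex_cat_altl)) /=.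
by rewrite [RHS]chainE.
Qed.

Lemma wedgec1 : right_id (osimplex [::]) (@wedge V).
Proof.
move=> c; rewrite wedgeE [RHS]chainE; apply: eq_bigr => A _; congr (_ *~ _).
by rewrite (ext_osimplex _ (@osimplex_cat_altr _)) cats0.
Qed.

Lemma wedgeDl : left_distributive (@wedge V) +%R.
Proof.
move=> c d e; exact: (zmod_morphismD (wedge_zmodl e)).
Qed.

Lemma wedgeDr : right_distributive (@wedge V) +%R.
Proof.
move=> c d e; exact: (zmod_morphismD (wedge_zmodr c)).
Qed.

Lemma osimplex_nil_neq0 : osimplex [::] != 0 :> chain V.
Proof.
apply/eqP => /(congr1 (fun c : chain V => c set0)); rewrite !ffunE.
have -> : [set x in [::]] = set0 :> {set V} by apply/setP => x; rewrite !inE.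
by rewrite eqxx /= expr0 => /eqP.
Qed.

End Ring.

(* The ring operations below are locked, since unification would otherwise unfold
   them into sums over all subsets. *)
HB.lock Definition ext_mul (V : finType) : chain V -> chain V -> chain V := @wedge V.
HB.lock Definition pt (V : finType) (x : V) : chain V := osimplex [:: x].

Section ExtMul.
Variable V : finType.
Lemma ext_mulA : associative (@ext_mul V). Proof. by rewrite unlock; apply: wedgeA. Qed.
Lemma ext_mul1c : left_id (osimplex [::]) (@ext_mul V).
Proof. by rewrite unlock; apply: wedge1c. Qed.
Lemma ext_mulc1 : right_id (osimplex [::]) (@ext_mul V).
Proof. by rewrite unlock; apply: wedgec1. Qed.
Lemma ext_mulDl : left_distributive (@ext_mul V) +%R.
Proof. by rewrite unlock; apply: wedgeDl. Qed.
Lemma ext_mulDr : right_distributive (@ext_mul V) +%R.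
Proof. by rewrite unlock; apply: wedgeDr. Qed.
End ExtMul.

HB.instance Definition _ (V : finType) := GRing.Zmodule_isNzRing.Build (chain V)
  (@ext_mulA V) (@ext_mul1c V) (@ext_mulc1 V) (@ext_mulDl V) (@ext_mulDr V)
  (@osimplex_nil_neq0 V).

(** * Antiderivations: the boundary and the links *)

Section Contraction.
Variables (V : finType).
Implicit Types (s t : seq V) (c : chain V).

Lemma osimplex0 : osimplex [::] = 1 :> chain V. Proof. by []. Qed.

Lemma mul_wedge c d : c * d = wedge c d.
Proof. by rewrite /GRing.mul /= unlock. Qed.

Lemma osimplex_cat s t : osimplex (s ++ t) = osimplex s * osimplex t.
Proof. by rewrite -wedge_osimplex mul_wedge. Qed.

Lemma osimplex_cons x s : osimplex (x :: s) = pt x * osimplex s.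
Proof. by rewrite -cat1s osimplex_cat unlock. Qed.

Lemma ptE (x : V) : pt x = osimplex [:: x].
Proof. by rewrite unlock. Qed.

Lemma ptC (x y : V) : pt x * pt y = - (pt y * pt x) :> chain V.
Proof. by rewrite unlock -!osimplex_cat /= (osimplex_alt [::]). Qed.

(* The antiderivation extending phi: the boundary for phi = 1, and the link of e
   when phi is the indicator of e. *)
Fixpoint contr_seq (phi : V -> int) s : chain V :=
  if s is x :: s' then osimplex s' *~ phi x - pt x * contr_seq phi s' else 0.

Lemma contr_seq_alt phi : alternating (contr_seq phi).
Proof.
move=> s1 x y s2; elim: s1 => [|z s1 IH] /=; last first.
  by rewrite IH osimplex_alt mulrN mulNrz opprD.
rewrite !osimplex_cons !mulrBr !mulrA (ptC y x) mulNr !opprB !opprK !mulrzAr.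
by rewrite addrA.
Qed.

Fact contraction_key : unit. Proof. by []. Qed.
Definition contraction phi : chain V -> chain V :=
  locked_with contraction_key (ext (contr_seq phi)).

Lemma contractionE phi : contraction phi = ext (contr_seq phi).
Proof. by rewrite /contraction unlock. Qed.

Lemma contraction_is_zmod_morphism phi : zmod_morphism (contraction phi).
Proof. by rewrite contractionE; apply: ext_is_zmod_morphism. Qed.

HB.instance Definition _ phi := GRing.isZmodMorphism.Build (chain V) (chain V)
  (contraction phi) (contraction_is_zmod_morphism phi).

Lemma contraction_osimplex phi s : contraction phi (osimplex s) = contr_seq phi s.
Proof. by rewrite contractionE; apply/ext_osimplex/contr_seq_alt. Qed.

Lemma contraction_ptM phi x c :
  contraction phi (pt x * c) = c *~ phi x - pt x * contraction phi c.
Proof.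
apply: (eq_zmod_morphism (f := fun c => contraction phi (pt x * c))
  (g := fun c => c *~ phi x - pt x * contraction phi c)) c.
- by move=> c d; rewrite mulrBr raddfB.
- by move=> c d; rewrite raddfB mulrBr /= mulrzBl !opprD !opprK addrACA.
by move=> s _; rewrite -osimplex_cons !contraction_osimplex.
Qed.

Lemma contraction1 phi : contraction phi 1 = 0.
Proof. by rewrite -osimplex0 contraction_osimplex. Qed.

Lemma contraction_pt phi x : contraction phi (pt x) = 1 *~ phi x.
Proof. by rewrite -[pt x]mulr1 contraction_ptM contraction1 mulr0 subr0. Qed.

Lemma contractionC phi psi c :
  contraction phi (contraction psi c) = - contraction psi (contraction phi c).
Proof.
apply: (eq_zmod_morphism (f := fun c => contraction phi (contraction psi c))
  (g := fun c => - contraction psi (contraction phi c))) c.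
- by move=> c d; rewrite !raddfB.
- by move=> c d; rewrite !raddfB.
move=> s _; elim: s => [|x s IH]; first by rewrite osimplex0 !contraction1 !raddf0.
rewrite osimplex_cons !contraction_ptM !raddfB !raddfMz /= !contraction_ptM IH.
by rewrite mulrN !opprK opprD ?mulNrz !addrA [- _ + _]addrC.
Qed.

Lemma contractionK phi c : contraction phi (contraction phi c) = 0.
Proof. exact/chain_opp_eq0/contractionC. Qed.

Definition bd : chain V -> chain V := contraction (fun=> 1).

HB.instance Definition _ := GRing.Additive.copy bd (contraction (fun=> 1)).

(** To reach the vertex at position i, the antiderivation passes i factors, which produces the sign
    of the alternating sum. *)
Lemma boundaryE c : boundary c = bd c.
Proof.
rewrite /boundary /bd contractionE /ext; apply: eq_bigr => A _.
have -> : \sum_(x in A) osimplex (rem x (enum A)) *~ ((-1) ^+ index x (enum A) * c A) =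
  (\sum_(x <- enum A) osimplex (rem x (enum A)) *~ (-1) ^+ index x (enum A)) *~ c A.
  by rewrite big_enum mulrz_suml; apply: eq_bigr => x _; rewrite mulrzA.
congr (_ *~ _); elim: (enum A) (enum_uniq A) => [|x s IH] /=; first by rewrite big_nil.
move=> /andP[xs us]; rewrite big_cons /= !eqxx expr0 -(IH us); congr (_ + _).
rewrite mulr_sumr -sumrN; apply: eq_big_seq => y ys.
have xy : x != y by apply: contraNneq xs => ->.
rewrite ?[y == x]eq_sym (negbTE xy) osimplex_cons exprS mulN1r mulrNz.
by rewrite mulrzAr.
Qed.

Definition homogeneous r c := forall A, c A != 0 -> #|A| = r.

Lemma contractionM phi r c d : homogeneous r c ->
  contraction phi (c * d) = contraction phi c * d + (c * contraction phi d) *~ (-1) ^+ r.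
Proof.
move=> hc; apply: (eq_zmod_morphism_in (f := fun c => contraction phi (c * d))
  (g := fun c => contraction phi c * d + (c * contraction phi d) *~ (-1) ^+ r)) hc.
- by move=> c' d'; rewrite mulrBl raddfB.
- by move=> c' d'; rewrite raddfB /= !mulrBl mulrzBl opprD addrACA.
move=> A <-.
rewrite cardE; elim: (enum A) => [|x s IH] /=.
  by rewrite osimplex0 !mul1r contraction1 expr0 mulr1z mul0r add0r.
rewrite osimplex_cons -mulrA !contraction_ptM IH mulrBl mulrDr opprD exprS mulN1r.
by rewrite mulrNz mulrzAr !mulrA mulrzAl addrA.
Qed.

End Contraction.

(** * Chains of matchings *)

Opaque wedge osimplex.

(* Matchings with r edges span the chains of degree r - 1. *)
Notation Ch S r := (in_degree (matching_complex S) (r%N%:Z - 1)).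
Notation Cy S r := (is_cycle (matching_complex S) (r%N%:Z - 1)).
Definition Bd (T : finType) (S : {set T}) (r : nat) (z : chain {set T}) :=
  exists2 w, w \in Ch S r.+1 & bd w = z.

Definition link (T : finType) (e : {set T}) : chain {set T} -> chain {set T} :=
  contraction (fun x => (x == e)%:R).

HB.instance Definition _ (T : finType) (e : {set T}) :=
  GRing.Additive.copy (link e) (contraction (fun x => (x == e)%:R)).

Lemma linkE (T : finType) (e : {set T}) c : link e c = contraction (fun x => (x == e)%:R) c.
Proof. by []. Qed.


Section MatchingChains.
Variable T : finType.
Implicit Types (S : {set T}) (c d : chain {set T}) (e : {set T}) (r : nat).

Lemma matchingP S (A : {set {set T}}) :
  reflect (trivIset A /\ forall e, e \in A -> #|e| = 2%N /\ e \subset S)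
          (A \in matching_complex S).
Proof.
rewrite inE; apply: (iffP andP) => -[hA h]; split=> //.
  by move=> e eA; have /andP[/eqP] := implyP (forallP h e) eA.
by apply/forallP => e; apply/implyP => /h[-> ->].
Qed.

Lemma ChP S r c :
  reflect (forall A, c A != 0 -> A \in matching_complex S /\ #|A| = r) (c \in Ch S r).
Proof.
apply: (iffP forallP) => h A; last first.
  by apply/implyP => /h[-> ->]; rewrite subrK eqxx.
by move=> cA; have /andP[-> /eqP] := implyP (h A) cA; rewrite subrK => -[].
Qed.

Lemma Ch_homogeneous S r c : c \in Ch S r -> homogeneous r c.
Proof. by move=> /ChP h A /h[]. Qed.

Lemma CyP S r c : reflect (c \in Ch S r /\ bd c = 0) (c \in Cy S r).
Proof. by rewrite -boundaryE; apply: (iffP andP) => -[h /eqP]. Qed.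

Lemma Cy_Ch S r c : c \in Cy S r -> c \in Ch S r. Proof. by case/CyP. Qed.

Lemma Ch_osimplex S (A : {set {set T}}) r : A \in matching_complex S -> #|A| = r ->
  osimplex (enum A) \in Ch S r.
Proof.
move=> hA hr; apply/ChP => B; rewrite osimplex_enum ffunE.
by have [->|_ /eqP] := eqVneq B A.
Qed.

Lemma Ch_additive (U : zmodType) (P : zmodClosed U) (f : chain {set T} -> U) S r c :
  zmod_morphism f ->
  (forall A, A \in matching_complex S -> #|A| = r -> f (osimplex (enum A)) \in P) ->
  c \in Ch S r -> f c \in P.
Proof.
move=> hf h /ChP hc.
pose F : {additive chain {set T} -> U} := HB.pack f (GRing.isZmodMorphism.Build _ _ f hf).
rewrite -[f]/(F : _ -> _) (chainE c) raddf_sum; apply: rpred_sum => A _.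
rewrite raddfMz; have [->|/hc [h1 h2]] := eqVneq (c A) 0; first by rewrite mulr0z rpred0.
exact/rpredMz/h.
Qed.

Lemma matching_sub S S' A : S \subset S' ->
  A \in matching_complex S -> A \in matching_complex S'.
Proof.
move=> sS /matchingP[tA h]; apply/matchingP; split=> // e /h[-> eS]; split=> //.
exact: subset_trans eS sS.
Qed.

Lemma Ch_sub S S' r c : S \subset S' -> c \in Ch S r -> c \in Ch S' r.
Proof. by move=> sS /ChP h; apply/ChP => A /h[/(matching_sub sS)]. Qed.

Lemma Cy_sub S S' r c : S \subset S' -> c \in Cy S r -> c \in Cy S' r.
Proof. by move=> sS /CyP[h0 h]; apply/CyP; split=> //; apply: Ch_sub h0. Qed.

Lemma Bd_sub S S' r c : S \subset S' -> Bd S r c -> Bd S' r c.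
Proof. by move=> sS [w hw <-]; exists w => //; apply: Ch_sub hw. Qed.

Lemma Ch1 S : 1 \in Ch S 0.
Proof.
apply/ChP => A; rewrite -osimplex0 osimplex_val /=.
case: ifP => // /eqP -> _; split; last by apply: eq_card0 => x; rewrite !inE.
apply/matchingP; split=> [|e]; last by rewrite !inE.
by apply/trivIsetP => e f; rewrite !inE.
Qed.

Lemma bd1 : bd 1 = 0 :> chain {set T}.
Proof. exact: contraction1. Qed.

Lemma Cy1 S : 1 \in Cy S 0.
Proof. by apply/CyP; rewrite bd1; split=> //; apply: Ch1. Qed.

Lemma Ch0E S c : c \in Ch S 0 -> c = 1 *~ c set0.
Proof.
move=> /ChP h; rewrite {1}(chainE c) (bigD1 set0) //= big1 => [|A nA].
  by rewrite addr0 enum_set0.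
have [->|/h[_ /cards0_eq A0]] := eqVneq (c A) 0; first by rewrite mulr0z.
by rewrite A0 eqxx in nA.
Qed.

Lemma ChM S1 S2 r1 r2 c d : [disjoint S1 & S2] ->
  c \in Ch S1 r1 -> d \in Ch S2 r2 -> c * d \in Ch (S1 :|: S2) (r1 + r2).
Proof.
move=> dS hc hd.
apply: (Ch_additive (f := fun c => c * d)) hc; first by move=> ? ?; rewrite mulrBl.
move=> A /matchingP[tA hA] Ar.
apply: (Ch_additive (f := fun d => osimplex (enum A) * d)) hd.
  by move=> ? ?; rewrite mulrBr.
move=> B /matchingP[tB hB] Br; rewrite -osimplex_cat; apply/ChP => C.
rewrite osimplex_val; case: ifP => // /andP[us /eqP ->] _.
have -> : [set x in enum A ++ enum B] = A :|: B.
  by apply/setP => x; rewrite !inE mem_cat !mem_enum.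
have dAB : [disjoint A & B].
  move: us; rewrite cat_uniq => /and3P[_ h _]; rewrite disjoint_subset.
  apply/subsetP => x xA; rewrite inE; apply: contra h => xB.
  by apply/hasP; exists x; rewrite mem_enum.
split; last by rewrite cardsU disjoint_setI0 // cards0 subn0 Ar Br.
apply/matchingP; split=> [|e]; last first.
  rewrite inE => /orP[/hA|/hB] [-> h]; split=> //.
    exact: subset_trans h (subsetUl _ _).
  exact: subset_trans h (subsetUr _ _).
have key e f : e \in A -> f \in B -> [disjoint e & f].
  move=> /hA[_ e1] /hB[_ f2].
  exact: disjointWl e1 (disjointWr f2 dS).
apply/trivIsetP => e f; rewrite !inE => /orP[eA|eB] /orP[fA|fB] nef.
- exact: (trivIsetP tA).
- exact: key.
- by rewrite disjoint_sym; apply: key.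
- exact: (trivIsetP tB).
Qed.

Lemma bd_ptM e c : bd (pt e * c) = c - pt e * bd c.
Proof. exact: contraction_ptM. Qed.

Lemma bd_pt e : bd (pt e) = 1.
Proof. exact: contraction_pt. Qed.

Lemma bdM S r c d : c \in Ch S r ->
  bd (c * d) = bd c * d + (c * bd d) *~ (-1) ^+ r.
Proof. by move=> /Ch_homogeneous; apply: contractionM. Qed.

Lemma CyM S1 S2 r1 r2 c d : [disjoint S1 & S2] ->
  c \in Cy S1 r1 -> d \in Cy S2 r2 -> c * d \in Cy (S1 :|: S2) (r1 + r2).
Proof.
move=> dS /CyP[hc bc] /CyP[hd bd]; apply/CyP; split; first exact: ChM.
by rewrite (bdM _ hc) bc bd mul0r mulr0 mul0rz addr0.
Qed.

Lemma Ch_pt S x y : x != y -> x \in S -> y \in S -> pt [set x; y] \in Ch S 1.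
Proof.
move=> nxy xS yS; rewrite ptE.
have -> : [:: [set x; y]] = enum [set [set x; y]] by rewrite enum_set1.
apply: Ch_osimplex; last by rewrite cards1.
apply/matchingP; split=> [|e].
  by apply/trivIsetP => e f /set1P -> /set1P ->; rewrite eqxx.
by move=> /set1P ->; rewrite cards2 nxy subUset !sub1set xS yS.
Qed.

Lemma osimplex_pick (A : {set {set T}}) e : e \in A -> exists b : nat,
  osimplex (enum A) = (pt e * osimplex (enum (A :\ e))) *~ (-1) ^+ b.
Proof.
move=> eA; have p : perm_eq (enum A) (e :: enum (A :\ e)).
  apply: uniq_perm; rewrite ?enum_uniq //= ?mem_enum ?inE ?eqxx ?enum_uniq //.
  by move=> x; rewrite inE !mem_enum !inE; case: eqP => [->|].
have [b h] := alt_perm p; exists b.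
by rewrite (h _ _ (@osimplex_alt _)) osimplex_cons.
Qed.

Lemma link_notin e s : e \notin s -> link e (osimplex s) = 0.
Proof.
elim: s => [|x s IH]; first by rewrite osimplex0 linkE contraction1.
rewrite inE negb_or osimplex_cons linkE contraction_ptM -linkE => /andP[nex /IH ->].
by rewrite mulr0 eq_sym (negbTE nex) mulr0z subr0.
Qed.

Lemma link_ptM e f c : link e (pt f * c) = (if f == e then c else 0) - pt f * link e c.
Proof. by rewrite linkE contraction_ptM -linkE; case: eqP; rewrite ?mulr1z ?mulr0z. Qed.

Lemma link_osimplex (A : {set {set T}}) e : e \in A -> exists b : nat,
  link e (osimplex (enum A)) = osimplex (enum (A :\ e)) *~ (-1) ^+ b.
Proof.
move=> eA; have [b ->] := osimplex_pick eA; exists b.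
by rewrite raddfMz /= link_ptM eqxx link_notin ?mem_enum ?inE ?eqxx // mulr0 subr0.
Qed.

Lemma matching_subset S (A B : {set {set T}}) : B \subset A ->
  A \in matching_complex S -> B \in matching_complex S.
Proof.
move=> sBA /matchingP[tA h]; apply/matchingP; split; first exact: trivIsetS tA.
by move=> e /(subsetP sBA)/h.
Qed.

Lemma contraction_link phi c : contraction phi c = \sum_e link e c *~ phi e.
Proof.
apply: (eq_zmod_morphism (f := contraction phi) (g := fun c => \sum_e link e c *~ phi e)) c.
- exact: raddfB.
- move=> c d; rewrite -sumrB; apply: eq_bigr => e _.
  by rewrite raddfB mulrzBl.
move=> s _; elim: s => [|x s IH].
  by rewrite contraction1 big1 // => e _; rewrite linkE contraction1 mul0rz.
rewrite osimplex_cons contraction_ptM IH mulr_sumr (bigD1 x) //= [RHS](bigD1 x) //=.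
rewrite opprD addrA; congr (_ + _).
  by rewrite link_ptM eqxx mulrzBl; congr (_ - _); apply: mulrzAr.
rewrite -sumrN; apply: eq_bigr => e nex.
rewrite link_ptM eq_sym (negbTE nex) sub0r mulNrz; congr (- _); exact: mulrzAr.
Qed.

Lemma Ch_contraction phi S r c : c \in Ch S r.+1 -> contraction phi c \in Ch S r.
Proof.
move=> hc; rewrite contraction_link; apply: rpred_sum => e _; apply: rpredMz.
apply: (Ch_additive (f := link e)) hc => [|A hA Ar]; first exact: raddfB.
have [eA|neA] := boolP (e \in A); last by rewrite link_notin ?mem_enum // rpred0.
have [b ->] := link_osimplex eA; apply/rpredMz/Ch_osimplex.
  exact: matching_subset (subsetDl _ _) hA.
by apply/eqP; rewrite -eqSS -Ar (cardsD1 e A) eA.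
Qed.

Lemma Ch_bd S r c : c \in Ch S r.+1 -> bd c \in Ch S r.
Proof. exact: Ch_contraction. Qed.

Lemma bdK c : bd (bd c) = 0.
Proof. exact: contractionK. Qed.

Lemma bd_sum (I : Type) (s : seq I) (P : pred I) (F : I -> chain {set T}) :
  bd (\sum_(i <- s | P i) F i) = \sum_(i <- s | P i) bd (F i).
Proof. exact: raddf_sum. Qed.

Lemma link_sum e (I : Type) (s : seq I) (P : pred I) (F : I -> chain {set T}) :
  link e (\sum_(i <- s | P i) F i) = \sum_(i <- s | P i) link e (F i).
Proof. exact: raddf_sum. Qed.

Lemma bd_link e c : bd (link e c) = - link e (bd c).
Proof. exact: contractionC. Qed.

Lemma Ch0_contraction phi S c : c \in Ch S 0 -> contraction phi c = 0.
Proof. by move=> /Ch0E ->; rewrite raddfMz /= contraction1 mul0rz. Qed.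

Lemma Ch0_link e S c : c \in Ch S 0 -> link e c = 0.
Proof. exact: Ch0_contraction. Qed.

Lemma Bd_Cy S r z : Bd S r z -> z \in Cy S r.
Proof.
by move=> [w hw <-]; apply/CyP; split; [apply: Ch_bd|apply: bdK].
Qed.

Lemma Ch_link S v a r c : c \in Ch S r.+1 -> link [set v; a] c \in Ch (S :\ v :\ a) r.
Proof.
apply: (Ch_additive (f := link [set v; a])) => [|A /matchingP[tA hA] Ar].
  exact: raddfB.
have [eA|neA] := boolP ([set v; a] \in A); last by rewrite link_notin ?mem_enum // rpred0.
have [b ->] := link_osimplex eA; apply/rpredMz/Ch_osimplex; last first.
  by apply/eqP; rewrite -eqSS -Ar (cardsD1 [set v; a] A) eA.
apply/matchingP; split; first exact: trivIsetS (subsetDl _ _) tA.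
move=> e /setD1P[ne he]; have [-> eS] := hA _ he; split=> //.
have := trivIsetP tA _ _ he eA ne; rewrite disjoint_subset => /subsetP d.
apply/subsetP => x xe; rewrite !inE (subsetP eS) // andbT.
by have := d x xe; rewrite !inE negb_or andbC.
Qed.

Lemma link_vertex v a S r c : v \notin S -> c \in Ch S r -> link [set v; a] c = 0.
Proof.
move=> vS hc; apply: (eq_zmod_morphism_in (P := fun A => A \in matching_complex S /\ #|A| = r)
  (f := link [set v; a]) (g := fun=> 0)) => [||A [/matchingP[_ hA] _]|A].
- exact: raddfB.
- by move=> ? ?; rewrite subr0.
- rewrite link_notin ?mem_enum //; apply: contra vS => /hA[_ /subsetP]; apply.
  by rewrite !inE eqxx.
- by move: (hc) => /ChP; apply.
Qed.

(** A matching has at most one edge at [v]. The sum therefore reproduces each matching that covers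
    [v] and vanishes on the others, so the difference keeps only matchings that avoid [v]. *)
Lemma vertex_expansion v S r c : c \in Ch S r ->
  c - \sum_(a in S :\ v) pt [set v; a] * link [set v; a] c \in Ch (S :\ v) r.
Proof.
apply: (Ch_additive (f := fun c => c - \sum_(a in S :\ v) pt [set v; a] * link [set v; a] c)).
  move=> c1 c2; have -> : \sum_(a in S :\ v) pt [set v; a] * link [set v; a] (c1 - c2) =
    \sum_(a in S :\ v) pt [set v; a] * link [set v; a] c1 -
    \sum_(a in S :\ v) pt [set v; a] * link [set v; a] c2.
    by rewrite -sumrB; apply: eq_bigr => a _; rewrite raddfB mulrBr.
  by rewrite !opprB [LHS](AC (2*2) ((1*4)*(3*2))).
move=> A hA0; have /matchingP[tA hA] := hA0 => Ar.
have [/existsP[a /andP[aS eA]]|/existsPn none] :=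
   boolP [exists a, (a \in S :\ v) && ([set v; a] \in A)].
  rewrite (bigD1 a) //= big1 => [|b /andP[bS nba]].
    have [b E] := osimplex_pick eA.
    have -> : pt [set v; a] * link [set v; a] (osimplex (enum A)) = osimplex (enum A).
      rewrite E raddfMz /= link_ptM eqxx link_notin ?mem_enum ?inE ?eqxx //.
      by rewrite mulr0 subr0; apply: mulrzAr.
    by rewrite addr0 subrr rpred0.
  rewrite link_notin ?mulr0 // mem_enum; apply/negP => fA.
  have := trivIsetP tA _ _ eA fA; case: eqVneq => [E _|_ /(_ isT)].
    have : b \in [set v; a] by rewrite E !inE eqxx orbT.
    by move: bS; rewrite !inE (negbTE nba) orbF => /andP[/negbTE->].
  by rewrite disjoint_subset => /subsetP/(_ v); rewrite !inE eqxx => /(_ isT).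
rewrite big1 => [|a aS]; last first.
  rewrite link_notin ?mulr0 // mem_enum.
  by have := none a; rewrite aS.
rewrite subr0; apply: Ch_osimplex => //; apply/matchingP; split=> // e eA.
have [e2 eS] := hA e eA; split=> //; apply/subsetP => x xe.
rewrite !inE (subsetP eS) // andbT; apply/eqP => xv; subst x.
move/eqP: e2 => /cards2P[y [z [nyz E]]].
have [a [Ea av]] : exists a, e = [set v; a] /\ a != v.
  move: xe; rewrite E !inE => /orP[]/eqP->; first by exists z; rewrite eq_sym.
  by exists y; rewrite setUC.
have := none a; rewrite !inE av -Ea eA andbT /= => /negP; apply.
by apply: (subsetP eS); rewrite Ea !inE eqxx orbT.
Qed.

End MatchingChains.

(* The subgroup spanned by G, saturated with respect to the integers in D. *)
Inductive hull (M : zmodType) (D : pred nat) (G : M -> Prop) : M -> Prop :=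
| hull_gen x : G x -> hull D G x
| hull0 : hull D G 0
| hullB x y : hull D G x -> hull D G y -> hull D G (x - y)
| hull_div m x : D m -> hull D G (x *+ m) -> hull D G x.

Definition mul_closed (D : pred nat) := D 1%N /\ forall m n, D m -> D n -> D (m * n)%N.

Section Hull.
Variables (M N : zmodType) (D : pred nat).
Implicit Types (G : M -> Prop) (H : N -> Prop).

Lemma hullN G x : hull D G x -> hull D G (- x).
Proof. by rewrite -sub0r; apply: hullB; apply: hull0. Qed.

Lemma hullD G x y : hull D G x -> hull D G y -> hull D G (x + y).
Proof. by move=> hx /hullN hy; rewrite -[y]opprK; apply: hullB. Qed.

Lemma hullMn G x n : hull D G x -> hull D G (x *+ n).
Proof. by move=> hx; elim: n => [|n IH]; [apply: hull0 | rewrite mulrS; apply: hullD]. Qed.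

Lemma hullMz G x n : hull D G x -> hull D G (x *~ n).
Proof. by case: n => n hx; rewrite /intmul; [|apply: hullN]; apply: hullMn. Qed.

Lemma hull_sum G (I : finType) (P : pred I) (F : I -> M) :
  (forall i, P i -> hull D G (F i)) -> hull D G (\sum_(i | P i) F i).
Proof. by move=> h; apply: big_ind => //; [apply: hull0 | move=> *; apply: hullD]. Qed.

Lemma hull_map (f : M -> N) G H x : zmod_morphism f ->
  (forall g, G g -> hull D H (f g)) -> hull D G x -> hull D H (f x).
Proof.
move=> hf h.
pose F : {additive M -> N} := HB.pack f (GRing.isZmodMorphism.Build _ _ f hf).
elim=> [{}x|||m {}x Dm _]; first exact: h.
- by rewrite -[f]/(F : _ -> _) raddf0; apply: hull0.
- by move=> a b _ ha _ hb; rewrite hf; apply: hullB.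
by rewrite -[f]/(F : _ -> _) raddfMn; apply: hull_div.
Qed.

End Hull.

Lemma hull_trans (M : zmodType) (D : pred nat) (G H : M -> Prop) x :
  (forall g, G g -> hull D H g) -> hull D G x -> hull D H x.
Proof. exact: (hull_map (f := id)). Qed.

(** Clearing denominators: as [D] is closed under products, a single multiplier from [D] serves a
    whole combination of generators. *)
Lemma hull_elim (M : zmodType) (D : pred nat) (P G : M -> Prop) x : mul_closed D ->
  P 0 -> (forall y z, P y -> P z -> P (y - z)) ->
  (forall g, G g -> exists2 m, D m & P (g *+ m)) ->
  hull D G x -> exists2 m, D m & P (x *+ m).
Proof.
move=> [D1 DM] P0 PB hG.
have PMn y n : P y -> P (y *+ n).
  move=> hy; elim: n => [|n IH]; first by rewrite mulr0n.
  by rewrite mulrS -[_ *+ n]opprK; apply/PB => //; rewrite -sub0r; apply: PB.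
elim=> [//||{}x y _ [m Dm hx] _ [n Dn hy]|m {}x Dm _ [n Dn h]].
- by exists 1%N; rewrite ?mul0rn.
- exists (m * n)%N; first exact: DM.
  rewrite mulrnBl; apply: PB; first by rewrite mulrnA; apply: PMn.
  by rewrite mulnC mulrnA; apply: PMn.
by exists (m * n)%N; [apply: DM|rewrite mulrnA].
Qed.

Section Boundaries.
Variable T : finType.
Implicit Types (S : {set T}) (c d x : chain {set T}).

Lemma Bd0 S r : Bd S r 0.
Proof. by exists 0; rewrite ?rpred0 ?raddf0. Qed.

Lemma BdB S r x y : Bd S r x -> Bd S r y -> Bd S r (x - y).
Proof. by move=> [w hw <-] [v hv <-]; exists (w - v); rewrite ?rpredB ?raddfB. Qed.

Lemma BdMr S1 S2 r1 r2 c d : [disjoint S1 & S2] ->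
  Bd S1 r1 c -> d \in Cy S2 r2 -> Bd (S1 :|: S2) (r1 + r2) (c * d).
Proof.
move=> dS [w hw <-] /CyP[hd bd]; exists (w * d); first by rewrite -addSn; apply: ChM.
by rewrite (bdM _ hw) bd mulr0 mul0rz addr0.
Qed.

Lemma BdMl S1 S2 r1 r2 c d : [disjoint S1 & S2] ->
  c \in Cy S1 r1 -> Bd S2 r2 d -> Bd (S1 :|: S2) (r1 + r2) (c * d).
Proof.
move=> dS /CyP[hc bc] [w hw <-]; exists ((c * w) *~ (-1) ^+ r1).
  by apply: rpredMz; rewrite -addnS; apply: ChM.
rewrite raddfMz /= (bdM _ hc) bc mul0r add0r -mulrzA -exprD addnn.
by rewrite -signr_odd odd_double mulr1z.
Qed.

(** The edge [ab] is disjoint from every matching in [x], so [x] bounds the cone over it. *)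
Lemma Bd_two_free S r a b x : a != b -> a \in S -> b \in S ->
  x \in Cy (S :\ a :\ b) r -> Bd S r x.
Proof.
move=> nab aS bS /CyP[hx bx]; exists (pt [set a; b] * x); last first.
  by rewrite bd_ptM bx mulr0 subr0.
apply: (@Ch_sub _ ([set a; b] :|: (S :\ a :\ b))).
  apply/subsetP => y; rewrite !inE => /orP[/orP[]/eqP->//|/and3P[]//].
rewrite -add1n; apply: ChM => //; last by rewrite Ch_pt ?inE ?eqxx ?orbT.
rewrite disjoint_subset; apply/subsetP => y; rewrite !inE.
by case/orP=> ->; rewrite ?andbF.
Qed.

Lemma osimplex_catC (V : finType) (s t : seq V) :
  osimplex (s ++ t) = osimplex (t ++ s) *~ (-1) ^+ (size s * size t).
Proof.
elim: s => [|x s IH]; first by rewrite cats0 mulr1z.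
rewrite cat_cons osimplex_cons IH /= mulSn exprD mulrzA.
have <- : osimplex (x :: t ++ s) = osimplex (t ++ x :: s) *~ (-1) ^+ size t.
  exact: (alt_move [::] x t s (@osimplex_alt _)).
by rewrite osimplex_cons; apply: mulrzAr.
Qed.

Lemma ChC S1 S2 r1 r2 c d : c \in Ch S1 r1 -> d \in Ch S2 r2 ->
  c * d = (d * c) *~ (-1) ^+ (r1 * r2).
Proof.
move=> /ChP hc /ChP hd.
apply: (eq_zmod_morphism_in (f := fun c => c * d) (P := fun A => #|A| = r1)
  (g := fun c => (d * c) *~ (-1) ^+ (r1 * r2))) => [c1 c2|c1 c2|A <-|A /hc[]//].
- by rewrite mulrBl.
- by rewrite mulrBr mulrzBl.
apply: (eq_zmod_morphism_in (f := fun d => osimplex (enum A) * d) (P := fun A => #|A| = r2)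
  (g := fun d => (d * osimplex (enum A)) *~ (-1) ^+ (#|A| * r2))) => [c1 c2|c1 c2|B <-|B /hd[]//].
- by rewrite mulrBr.
- by rewrite mulrBl mulrzBl.
by rewrite -!osimplex_cat !cardE osimplex_catC.
Qed.

End Boundaries.

(** * Links at two vertices *)

Lemma addr_swap_cancel (M : zmodType) (p q r x y z : M) :
  p + x + (y + z) = x - q + (y - r) + (z - (- p - q - r)).
Proof.
rewrite !opprD !opprK.
by rewrite [RHS](AC ((2*2)*(1*3)) (((6*1)*(3*5))*((7*2)*(8*4)))) /= !subrr !addr0.
Qed.

Section Generation.
Variable T : finType.
Implicit Types (S : {set T}) (c d x z : chain {set T}).

Definition tri (v a b : T) : chain {set T} := pt [set v; a] - pt [set v; b].

(* The pentagon va, wb, ac, vw, bc: among the 1-simplices v x /\ w y of the matching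
   complex, it contains v a /\ w b only. *)
Definition pent (v w a b c : T) : chain {set T} :=
  pt [set v; a] * pt [set w; b] + pt [set w; b] * pt [set a; c]
  + pt [set a; c] * pt [set v; w] + pt [set v; w] * pt [set b; c]
  + pt [set b; c] * pt [set v; a].

Variables (D : pred nat) (G : chain {set T} -> Prop) (S : {set T}) (r : nat) (v1 v2 : T).
Let B := S :\ v1 :\ v2.

(** Expanding at [v1] and then at [v2] writes [z] through edges [v1 a], edges [v2 b] and a rest [u]
    that avoids both vertices. Replacing each such edge by its difference with the edge [v1 v2]
    creates triangles, and the error is absorbed by the boundary of [v1 v2] times [u]. *)
Lemma hull_no_links z :
  v1 \in S -> v2 \in S -> v1 != v2 ->
  (forall x, Bd S r x -> hull D G x) ->
  (forall r' a s, r = r'.+1 -> a \in B -> s \in Cy (B :\ a) r' ->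
     hull D G (tri v1 a v2 * s) /\ hull D G (tri v2 a v1 * s)) ->
  z \in Cy S r ->
  (forall a b, a \in B -> b \in B -> a != b -> link [set v2; b] (link [set v1; a] z) = 0) ->
  hull D G z.
Proof.
move=> v1S v2S n12 hBd htri /CyP[hz bz] no.
pose l a := link [set v1; a] z.
pose c0 := z - \sum_(a in S :\ v1) pt [set v1; a] * l a.
pose t b := link [set v2; b] c0.
pose u := c0 - \sum_(b in B) pt [set v2; b] * t b.
have hc0 : c0 \in Ch (S :\ v1) r by exact: vertex_expansion.
have hu : u \in Ch B r by exact: vertex_expansion.
have v2B : v2 \notin B by rewrite !inE eqxx.
have BS a : a \in B -> a \in S :\ v1 by rewrite !inE => /andP[].
have lE a : link [set v2; a] (l v2) = 0.
  rewrite /l; case: r hz => [|r'] hz; first by rewrite [X in link _ X](Ch0_link _ hz) raddf0.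
  exact: (link_vertex _ v2B (Ch_link _ _ hz)).
(* A priori [l a] avoids only [v1] and [a]. The vanishing of the double links removes every term of
   its expansion at [v2], so it avoids [v2] as well and can multiply the triangle on [v1], [a],
   [v2]. *)
have hl r' a : r = r'.+1 -> a \in B -> l a \in Ch (B :\ a) r'.
  move=> rE aB; rewrite /l; move: hz; rewrite rE => hz.
  have h1 := Ch_link v1 a hz.
  have := vertex_expansion v2 h1; rewrite big1 ?subr0 => [|b].
    by apply: Ch_sub; apply/subsetP => y; rewrite !inE => /and4P[-> -> -> ->].
  rewrite !inE => /and4P[b2 ba b1 bS]; rewrite no ?mulr0 // ?inE ?b2 ?b1 //.
  by rewrite eq_sym.
have l0 a : r = 0%N -> l a = 0 /\ t a = 0.
  by move=> r0; rewrite /l /t; move: hz hc0; rewrite r0 => hz' hc'; rewrite (Ch0_link _ hz') (Ch0_link _ hc').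
have llE a b : a \in B -> link [set v2; b] (l a) = 0.
  move=> aB; case E: r => [|r']; first by rewrite (l0 a E).1 raddf0.
  by apply: (link_vertex _ _ (hl r' a E aB)); rewrite !inE eqxx !andbF.
have bl a : bd (l a) = 0 by rewrite /l bd_link bz raddf0 oppr0.
have bc0 : bd c0 = - l v2 - \sum_(a in B) l a.
  rewrite /c0 raddfB /= bz sub0r bd_sum (bigD1 v2) ?inE ?v2S ?(eq_sym v2) ?n12 //=.
  rewrite bd_ptM bl mulr0 subr0 opprD; congr (_ - _).
  rewrite (eq_bigl (mem B)) => [|a]; last by rewrite !inE andbC.
  by apply: eq_bigr => a aB; rewrite bd_ptM bl mulr0 subr0.
have bt b : bd (t b) = 0.
  rewrite /t bd_link bc0 raddfB raddfN /= lE oppr0 sub0r link_sum big1 ?oppr0 //.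
  by move=> a /llE.
have bu : bd u = - l v2 - \sum_(a in B) l a - \sum_(b in B) t b.
  rewrite /u raddfB /= bc0 bd_sum; congr (_ - _); apply: eq_bigr => b _.
  by rewrite bd_ptM bt mulr0 subr0.
(* By [bu], the corrections from the triangles add up to the edge [v1 v2] times the boundary of [u],
   which together with [u] is the boundary of the last term. *)
have zE : z = \sum_(a in B) tri v1 a v2 * l a + \sum_(b in B) tri v2 b v1 * t b
            + bd (pt [set v1; v2] * u).
  have -> : z = \sum_(a in S :\ v1) pt [set v1; a] * l a + c0 by rewrite addrC subrK.
  have -> : c0 = \sum_(b in B) pt [set v2; b] * t b + u by rewrite addrC subrK.
  rewrite bd_ptM bu (bigD1 v2) ?inE ?v2S ?(eq_sym v2) ?n12 //=.
  rewrite (eq_bigl (mem B)) => [|a]; last by rewrite !inE andbC.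
  under [X in _ = X + _ + _]eq_bigr => a _ do rewrite mulrBl.
  under [X in _ = _ + X + _]eq_bigr => a _ do rewrite mulrBl [[set v2; v1]]setUC.
  rewrite !sumrB -!mulr_sumr !mulrBr mulrN.
  exact: addr_swap_cancel.
rewrite zE; apply: hullD; last first.
  apply: hBd; exists (pt [set v1; v2] * u) => //.
  apply: (@Ch_sub _ ([set v1; v2] :|: B)).
    by apply/subsetP => y; rewrite !inE => /orP[/orP[]/eqP->//|/and3P[]//].
  rewrite -add1n; apply: ChM => //; last by rewrite Ch_pt ?inE ?eqxx ?orbT.
  rewrite disjoint_subset; apply/subsetP => y; rewrite !inE.
  by case/orP=> ->; rewrite ?andbF.
rewrite -big_split; apply: hull_sum => a aB /=.
case E: r => [|r'].
  by have [-> ->] := l0 a E; rewrite !mulr0 addr0; apply: hull0.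
apply: hullD.
  by apply: (htri r' _ _ E aB _).1; apply/CyP; split; [apply: hl|].
apply: (htri r' _ _ E aB _).2; apply/CyP; split=> //.
have := hc0; rewrite E => /(Ch_link v2 a); apply: Ch_sub.
by apply/subsetP => y; rewrite !inE => /and4P[-> -> -> ->].
Qed.

End Generation.

(** * Lifting cycles with a prescribed double link *)

Section Lifting.
Variable T : finType.
Implicit Types (S U : {set T}) (z : chain {set T}).

Lemma eq_edge (v a b : T) : ([set v; a] == [set v; b]) = (a == b).
Proof.
apply/eqP/eqP => [E|->//].
have: a \in [set v; b] by rewrite -E !inE eqxx orbT.
rewrite !inE => /orP[/eqP av|/eqP//]; subst v.
have: b \in [set a; a] by rewrite E !inE eqxx orbT.
by rewrite !inE orbb => /eqP.
Qed.

Lemma neq_edge (v a x y : T) : x != v -> y != v -> ([set x; y] == [set v; a]) = false.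
Proof.
move=> xv yv; apply/eqP => E.
have: v \in [set x; y] by rewrite E !inE eqxx.
by rewrite !inE eq_sym (negbTE xv) eq_sym (negbTE yv).
Qed.

Lemma disjointD U S : [disjoint U & S :\: U].
Proof.
rewrite -setI_eq0; apply/eqP/setP => t; rewrite in_setI in_setD in_set0.
by case: (t \in U).
Qed.

Definition is_tri U z :=
  exists v a b : T, [/\ uniq [:: v; a; b], U = [set v; a; b] & z = tri v a b].

Definition is_pent U z := exists v w a b c : T,
  [/\ uniq [:: v; w; a; b; c], U = [set x in [:: v; w; a; b; c]] & z = pent v w a b c].

Lemma Ch_pt2 S (x y z t : T) : uniq [:: x; y; z; t] -> {subset [:: x; y; z; t] <= S} ->
  pt [set x; y] * pt [set z; t] \in Ch S 2.
Proof.
move=> /= /and4P[]; rewrite !inE !negb_or => /and3P[nxy nxz nxt] /andP[nyz nyt] nzt _ sS.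
apply: (@Ch_sub _ ([set x; y] :|: [set z; t])).
  apply/subsetP => w; rewrite !inE => h; apply: sS; rewrite !inE.
  by case/orP: h => /orP[] ->; rewrite ?orbT.
apply: (@ChM _ _ _ 1 1); try by rewrite Ch_pt ?inE ?eqxx ?orbT.
rewrite disjoint_subset; apply/subsetP => w; rewrite !inE.
by case/orP=> /eqP->; rewrite negb_or ?nxz ?nxt ?nyz.
Qed.

Lemma bd_pt2 (e f : {set T}) : bd (pt e * pt f) = pt f - pt e.
Proof. by rewrite bd_ptM bd_pt mulr1. Qed.

Lemma pent_Cy U z : is_pent U z -> z \in Cy U 2.
Proof.
move=> [v [w [a [b [c [us -> ->]]]]]].
have := us; rewrite /= !inE !negb_or => /and5P[/and4P[h1 h2 h3 h4] /and3P[h5 h6 h7]].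
move=> /andP[h8 h9] h10 _; apply/CyP; split; last first.
  rewrite /pent !raddfD /= !bd_pt2.
  rewrite [LHS](AC (((2*2*2)*2)*2) ((1*4)*(3*6)*(5*8)*(7*10)*(9*2))) /=.
  by rewrite ?[- _ + _]addrC !subrr !addr0.
rewrite /pent !rpredD //; apply: Ch_pt2 => /=.
all: try by rewrite !inE !negb_or ?h1 ?h2 ?h3 ?h4 ?h5 ?h6 ?h7 ?h8 ?h9 ?h10
  ?[a == v]eq_sym ?[b == v]eq_sym ?[c == v]eq_sym ?[w == v]eq_sym ?[a == w]eq_sym
  ?[b == w]eq_sym ?[c == w]eq_sym ?[b == a]eq_sym ?[c == a]eq_sym ?[c == b]eq_sym
  ?h1 ?h2 ?h3 ?h4 ?h5 ?h6 ?h7 ?h8 ?h9 ?h10.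
all: by move=> x; rewrite !inE => /or4P[] ->; rewrite ?orbT.
Qed.

Lemma tri_Cy U z : is_tri U z -> z \in Cy U 1.
Proof.
move=> [v [a [b [us -> ->]]]].
have := us; rewrite /= !inE negb_or => /and3P[/andP[h1 h2] h3 _].
apply/CyP; split; last by rewrite raddfB /= !bd_pt subrr.
by rewrite rpredB // Ch_pt // !inE eqxx ?orbT.
Qed.

Section Peel.
Variables (D : pred nat) (G : chain {set T} -> Prop) (S : {set T}) (r : nat) (v1 v2 : T).
Let B := S :\ v1 :\ v2.

(** The lift must have no double link at any other pair, so that subtracting it does not disturb
    links that already vanish; the multiple [m] is harmless because [hull] is saturated with respect
    to [D]. *)
Definition liftable (a b : T) (x : chain {set T}) := exists m zl, [/\ D m, zl \in Cy S r, hull D G zl &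
  forall a' b', a' \in B -> b' \in B -> a' != b' ->
    link [set v2; b'] (link [set v1; a'] zl) = if (a' == a) && (b' == b) then x *+ m else 0].

Hypothesis v1S : v1 \in S.
Hypothesis v2S : v2 \in S.
Hypothesis n12 : v1 != v2.
Hypothesis hBd : forall x, Bd S r x -> hull D G x.
Hypothesis D_mul : mul_closed D.

(** Subtracting lifts removes the double links one pair at a time, until [hull_no_links] applies. *)
Lemma hull_peel z :
  (forall r' a s, r = r'.+1 -> a \in B -> s \in Cy (B :\ a) r' ->
     hull D G (tri v1 a v2 * s) /\ hull D G (tri v2 a v1 * s)) ->
  (forall r' a b x, r = r'.+2 -> a \in B -> b \in B -> a != b ->
     x \in Cy (B :\ a :\ b) r' -> liftable a b x) ->
  z \in Cy S r -> hull D G z.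
Proof.
move=> htri hlift.
(* [L] lists the pairs at which the double link may still be nonzero: initially all pairs, and none
   at the end of the induction. *)
suff h (L : seq (T * T)) : forall z, z \in Cy S r ->
    (forall a b, a \in B -> b \in B -> a != b -> (a, b) \notin L ->
       link [set v2; b] (link [set v1; a] z) = 0) -> hull D G z.
  by move=> hz; apply: (h (enum {: T * T})) => // a b _ _ _; rewrite mem_enum.
elim: L => [|[a b] L IH] {}z hz no.
  by apply: (hull_no_links v1S v2S n12 hBd htri hz) => a b aB bB nab; apply: no.
have [/and3P[aB bB nab]|inv] := boolP [&& a \in B, b \in B & a != b]; last first.
  apply: IH => // a' b' aB bB nab nL; apply: no => //.
  by rewrite inE negb_or nL andbT; apply: contraNneq inv => -[<- <-]; rewrite aB bB.
case rE: r => [|[|r']].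
- by apply: (IH _ hz) => a' b' *; move: (Cy_Ch hz); rewrite rE => /Ch0_link->; rewrite raddf0.
- apply: (IH _ hz) => a' b' *; move: (Cy_Ch hz); rewrite rE => /(Ch_link v1 a').
  by move/Ch0_link->.
pose x := link [set v2; b] (link [set v1; a] z).
have hx : x \in Cy (B :\ a :\ b) r'.
  have [hz1 hz2] := CyP _ _ _ hz; apply/CyP; split; last first.
    by rewrite !bd_link hz2 !(raddf0, oppr0).
  move: hz1; rewrite rE => /(Ch_link v1 a)/(Ch_link v2 b); apply: Ch_sub.
  by apply/subsetP => y; rewrite !inE => /and5P[-> -> -> -> ->].
have [m [zl [Dm hzl hG h]]] := hlift _ _ _ _ rE aB bB nab hx.
apply: (hull_div Dm); rewrite -[z *+ m](subrK zl); apply: hullD => //.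
apply: IH => [|a' b' a'B b'B nab' nL]; first by rewrite rpredB ?rpredMn.
rewrite !raddfB !raddfMn /= h //.
case: ifP => [/andP[/eqP-> /eqP->]|ne]; first by rewrite subrr.
rewrite subr0 no ?mul0rn // inE negb_or nL andbT.
by apply: contraFneq ne => -[-> ->]; rewrite !eqxx.
Qed.

(** A boundary lifts to the boundary of its filling multiplied by both edges. A cycle missing a
    vertex [c] lifts to its product with the pentagon on [v1], [v2], [a], [b], [c], in which the
    required pair of edges occurs exactly once. *)
Lemma liftable_hull r' a b x : r = r'.+2 -> a \in B -> b \in B -> a != b ->
  (forall U y s, U \subset S -> is_pent U y -> s \in Cy (S :\: U) r' -> hull D G (y * s)) ->
  hull D (fun y => Bd (B :\ a :\ b) r' y \/
     exists2 c : T, c \in B :\ a :\ b & y \in Cy (B :\ a :\ b :\ c) r') x ->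
  liftable a b x.
Proof.
move=> rE aB bB nab hpent.
have lkE x' c' a' : x' \in Ch (B :\ a :\ b) c' -> link [set v1; a'] x' = 0.
  by apply: link_vertex; rewrite !inE eqxx !andbF.
have lkE2 x' c' a' : x' \in Ch (B :\ a :\ b) c' -> link [set v2; a'] x' = 0.
  by apply: link_vertex; rewrite !inE eqxx !andbF.
have [n1a n1b] : a != v1 /\ b != v1.
  by move: aB bB; rewrite !inE => /and3P[_ -> _] /and3P[_ -> _].
have [n2a n2b] : a != v2 /\ b != v2.
  by move: aB bB; rewrite !inE => /and3P[-> _ _] /and3P[-> _ _].
elim=> [y [[w hw <-]|[c cB /CyP[hy by0]]]||y y' _ [m [zl [Dm hz hG h]]] _ [m' [zl' [Dm' hz' hG' h']]]|m y Dm _ [m' [zl [Dm' hz hG h]]]].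
(* The two links each anticommute with the boundary, so the double link of this boundary is the
   boundary of the double link of the cone, which is [w] at the pair [a], [b] and zero elsewhere. *)
- exists 1%N, (bd (pt [set v1; a] * (pt [set v2; b] * w))).
  have hB : Bd S r (bd (pt [set v1; a] * (pt [set v2; b] * w))).
    eexists; last by [].
    apply: (@Ch_sub _ ([set v1; a] :|: ([set v2; b] :|: (B :\ a :\ b)))).
      apply/subsetP => t; rewrite !inE; case/or3P.
      - by case/orP => /eqP->; rewrite // (subsetP (subset_trans (subsetDl _ _) (subsetDl _ _)) _ aB).
      - by case/orP => /eqP->; rewrite // (subsetP (subset_trans (subsetDl _ _) (subsetDl _ _)) _ bB).
      - by case/and5P.
    rewrite rE -[r'.+3]/(1 + (1 + r'.+1))%N; apply: ChM; last first.
    + apply: ChM => //; last by rewrite Ch_pt ?inE ?eqxx ?orbT // eq_sym.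
      rewrite disjoint_subset; apply/subsetP => t; rewrite !inE.
      by case/orP=> /eqP ->; rewrite eqxx ?andbF.
    + by rewrite Ch_pt ?inE ?eqxx ?orbT // eq_sym.
    rewrite disjoint_subset; apply/subsetP => t; rewrite !inE.
    by case/orP=> /eqP ->; rewrite eqxx ?andbF ?orbF negb_or ?n12 ?n2a ?nab // eq_sym.
  split; [exact: D_mul.1|exact: Bd_Cy|exact: hBd|].
  move=> a' b' a'B b'B na'b'.
  have -> : link [set v2; b'] (link [set v1; a'] (bd (pt [set v1; a] * (pt [set v2; b] * w)))) =
     bd (link [set v2; b'] (link [set v1; a'] (pt [set v1; a] * (pt [set v2; b] * w)))).
    by rewrite !bd_link !raddfN opprK.
  have -> : link [set v1; a'] (pt [set v1; a] * (pt [set v2; b] * w)) =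
      if a == a' then pt [set v2; b] * w else 0.
    rewrite link_ptM eq_edge (link_ptM [set v1; a']) neq_edge //; last by rewrite eq_sym.
    by rewrite (lkE _ _ _ hw) mulr0 subr0 mulr0 subr0.
  rewrite [a' == a]eq_sym [b' == b]eq_sym; case: (a == a') => /=; last by rewrite !raddf0.
  rewrite link_ptM eq_edge (lkE2 _ _ _ hw) mulr0 subr0 mulr1n.
  by case: (b == b'); rewrite ?raddf0.
- have := cB; rewrite !inE => /and5P[ncb nca nc2 nc1 cS].
  have us : uniq [:: v1; v2; a; b; c].
    by rewrite /= !inE !negb_or n12 nab 1?eq_sym n1a 1?eq_sym n1b 1?eq_sym nc1
       1?eq_sym n2a 1?eq_sym n2b 1?eq_sym nc2 1?eq_sym nca eq_sym ncb.
  pose U := [set x in [:: v1; v2; a; b; c]].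
  have hP : is_pent U (pent v1 v2 a b c) by exists v1, v2, a, b, c.
  have US : U \subset S.
    have [aS bS] : a \in S /\ b \in S.
      by move: aB bB; rewrite !inE => /and3P[_ _ ->] /and3P[_ _ ->].
    apply/subsetP => t; rewrite !inE.
    by case/or4P => [/eqP->|/eqP->|/eqP->|/orP[]/eqP->].
  have SU : S :\: U = B :\ a :\ b :\ c.
    apply/setP => t; rewrite !inE !negb_or.
    by case: (t == v1); case: (t == v2); case: (t == a); case: (t == b); case: (t == c);
      rewrite /= ?andbF.
  have hy' : y \in Cy (S :\: U) r' by rewrite SU; apply/CyP.
  exists 1%N, (pent v1 v2 a b c * y); split; first exact: D_mul.1.
  + rewrite rE -[r'.+2]/(2 + r')%N.
    apply: (@Cy_sub _ (U :|: S :\: U)); first by rewrite subUset US subsetDl.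
    apply: CyM hy'; last exact: pent_Cy.
    exact: disjointD.
  + exact: hpent US hP hy'.
  move=> a' b' a'B b'B na'b'.
  have hy1 : y \in Ch (B :\ a :\ b) r' by apply: Ch_sub hy; apply: subsetDl.
  have [l1 l2] := (lkE _ _ a' hy1, lkE2 _ _ b' hy1).
  have a'2 : (v2 == a') = false by move: a'B; rewrite !inE eq_sym => /andP[/negbTE].
  have [m1 m2] : (v2 != v1) * (c != v1) by rewrite eq_sym n12 nc1.
  have t1 : link [set v1; a'] (pt [set v1; a] * (pt [set v2; b] * y)) =
      if a == a' then pt [set v2; b] * y else 0.
    by rewrite link_ptM eq_edge (link_ptM [set v1; a']) neq_edge // l1 mulr0 subr0 mulr0 subr0.
  have t2 : link [set v1; a'] (pt [set v2; b] * (pt [set a; c] * y)) = 0.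
    by rewrite !link_ptM !neq_edge // l1 !(mulr0, subr0).
  have t3 : link [set v1; a'] (pt [set a; c] * (pt [set v1; v2] * y)) = 0.
    by rewrite !link_ptM neq_edge // eq_edge a'2 l1 !(mulr0, subr0).
  have t4 : link [set v1; a'] (pt [set v1; v2] * (pt [set b; c] * y)) = 0.
    by rewrite !link_ptM eq_edge a'2 neq_edge // l1 !(mulr0, subr0).
  have t5 : link [set v2; b'] (link [set v1; a'] (pt [set b; c] * (pt [set v1; a] * y))) = 0.
    rewrite !link_ptM neq_edge // eq_edge l1 mulr0 subr0 sub0r raddfN /= link_ptM neq_edge //.
    by case: eqP => _; rewrite ?l2 ?raddf0 mulr0 subr0 oppr0.
  rewrite /pent !mulrDl -!mulrA !raddfD /= t1 t2 t3 t4 t5 !raddf0 !addr0 mulr1n.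
  rewrite [a' == a]eq_sym [b' == b]eq_sym; case: (a == a') => /=; last by rewrite raddf0.
  by rewrite link_ptM eq_edge l2 mulr0 subr0.
- exists 1%N, 0; split=> [|||a' b' _ _ _]; rewrite ?rpred0 //; first exact: D_mul.1.
    exact: hull0.
  by rewrite !raddf0 mulr1n if_same.
(* The multipliers of the two lifts are made equal by crossing them. *)
- exists (m * m')%N, (zl *+ m' - zl' *+ m); split; first exact: D_mul.2.
  + by rewrite rpredB ?rpredMn.
  + by apply: hullB; apply: hullMn.
  move=> a' b' a'B b'B nab'; rewrite !raddfB !raddfMn /= h // h' //.
  case: ifP => _; last by rewrite !(mul0rn, oppr0, addr0).
  by rewrite mulrnBl mulNrn -!mulrnA [(m' * m)%N]mulnC.
exists (m * m')%N, zl; split=> //; first exact: D_mul.2.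
by move=> a' b' a'B b'B nab'; rewrite h // -mulrnA.
Qed.

End Peel.
End Lifting.

(** * Chessboard cycles and explicit relations *)

(* lap g [:: b_0; b_1; ...] is the sum over i of (-1)^i g b_i [:: b_j | j != i]. *)
Fixpoint lap (U : eqType) (M : zmodType) (g : U -> seq U -> M) (s : seq U) : M :=
  if s is b :: s' then g b s' - lap (fun x l => g x (b :: l)) s' else 0.

Section Lap.
Variables (U : eqType) (M : zmodType).
Implicit Types (g h : U -> seq U -> M) (s : seq U).

Lemma eq_lap g h s : (forall x l, perm_eq (x :: l) s -> g x l = h x l) ->
  lap g s = lap h s.
Proof.
elim: s g h => //= b s IH g h E; rewrite E //; congr (_ - _); apply: IH => x l p.
apply: E; rewrite -(perm_cons b) in p; apply: perm_trans p.
by rewrite -cat1s -(cat1s b) perm_catCA.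
Qed.

Lemma lapB g h s : lap (fun x l => g x l - h x l) s = lap g s - lap h s.
Proof.
elim: s g h => [|b s IH] g h /=; first by rewrite subrr.
by rewrite IH !opprB [LHS](AC (2*2) ((1*4)*(3*2))).
Qed.

Lemma lap0 s : lap (fun _ _ => 0 : M) s = 0.
Proof. by elim: s => //= b s ->; rewrite subrr. Qed.

Lemma lap_map (N : zmodType) (f : M -> N) g s : zmod_morphism f ->
  f (lap g s) = lap (fun x l => f (g x l)) s.
Proof.
move=> hf; elim: s g => [|b s IH] g /=; last by rewrite hf IH.
by rewrite -(subrr 0) hf subrr.
Qed.

Lemma lap_mem (P : zmodClosed M) g s :
  (forall x l, perm_eq (x :: l) s -> g x l \in P) -> lap g s \in P.
Proof.
elim: s g => [|b s IH] g h /=; first exact: rpred0.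
apply: rpredB; first exact: h.
apply: IH => x l p; apply: h; rewrite -(perm_cons b) in p; apply: perm_trans p.
by rewrite -cat1s -(cat1s b) perm_catCA.
Qed.

(** Two entries are deleted from the word; exchanging which of them goes first reverses the sign, as
    in a Laplace expansion along two rows. *)
Lemma lap_swap (h : U -> U -> seq U -> M) s :
  lap (fun x l => lap (fun y l' => h x y l') l) s =
  - lap (fun x l => lap (fun y l' => h y x l') l) s.
Proof.
elim: s h => [|b s IH] h /=; first by rewrite oppr0.
rewrite !lapB (IH (fun x y l => h x y (b :: l))) opprK opprD opprB.
by rewrite addrA addrAC.
Qed.

End Lap.

Section Chessboard.
Variable T : finType.
Implicit Types (S U : {set T}).

(* The fundamental cycle of the chessboard complex with rows s and columns t, when
   t has one element more than s. *)
Fixpoint bc (s t : seq T) : chain {set T} :=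
  if s is a :: s' then lap (fun b l => pt [set a; b] * bc s' l) t else 1.

(** With two columns too many, expand along the first row and exchange the omitted column with the
    one matched to that row: the inner sum is the same statement with one row less. The base case is
    1 - 1. This is why chessboard chains with one extra column are cycles. *)
Lemma lap_bc s t : size t = (size s).+2 -> lap (fun _ l => bc s l) t = 0.
Proof.
elim: s t => [|a s IH] t ht /=.
  by case: t ht => [|x [|y []]] //= _; rewrite subr0 subrr.
have E : lap (fun _ l => bc (a :: s) l) t =
  - lap (fun x l => lap (fun y l' => pt [set a; x] * bc s l') l) t.
  exact: (lap_swap (fun x y l => pt [set a; y] * bc s l)).
rewrite E -[RHS]oppr0 -(lap0 _ t); congr (- _); apply: eq_lap => x l p.
rewrite -(lap_map (fun _ => bc s) l (f := fun c => pt [set a; x] * c)) => [|c d].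
  by rewrite IH ?mulr0 //; have := perm_size p; rewrite ht => -[].
by rewrite mulrBr.
Qed.

Lemma bd_bc s t : size t = (size s).+1 -> bd (bc s t) = 0.
Proof.
elim: s t => [|a s IH] t ht /=; first exact: bd1.
rewrite (lap_map _ _ (raddfB (@bd _))).
rewrite (@eq_lap _ _ _ (fun _ l => bc s l)) ?lap_bc // => x l p.
rewrite /= bd_ptM IH ?mulr0 ?subr0 //.
by have := perm_size p; rewrite ht => -[].
Qed.

Lemma Ch_bc s t : uniq (s ++ t) -> bc s t \in Ch [set x in s ++ t] (size s).
Proof.
elim: s t => [|a s IH] t ut /=; first exact: Ch1.
apply: lap_mem => x l p.
have pt' : perm_eq ((a :: s) ++ t) ([:: a; x] ++ (s ++ l)).
  by rewrite /= perm_cons perm_sym -cat1s perm_catCA perm_cat2l.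
have := ut; rewrite (perm_uniq pt') cat_uniq => /and3P[ax hax usl].
apply: (@Ch_sub _ ([set a; x] :|: [set y in s ++ l])).
  apply/subsetP => y yU; rewrite in_set (perm_mem pt') mem_cat.
  by move: yU; rewrite in_setU in_set2 in_set !inE mem_cat.
rewrite -add1n; apply: ChM; last exact: IH.
  rewrite disjoint_subset; apply/subsetP => y yax; rewrite !inE.
  apply: contra hax => yl; apply/hasP; exists y => //.
  by move: yax; rewrite !inE.
by rewrite Ch_pt ?inE ?eqxx ?orbT //; move: ax; rewrite /= inE andbT.
Qed.

Lemma Cy_bc s t : uniq (s ++ t) -> size t = (size s).+1 ->
  bc s t \in Cy [set x in s ++ t] (size s).
Proof. by move=> us ht; apply/CyP; rewrite bd_bc //; split=> //; apply: Ch_bc. Qed.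

Lemma bc1 v a b : bc [:: v] [:: a; b] = tri v a b.
Proof. by rewrite /= !mulr1 subr0. Qed.

End Chessboard.

(* Edges are normalized to i < j by fedge. *)
Definition edge := (nat * nat)%type.
Definition fpoly := seq (int * seq edge).

Definition fopp (f : fpoly) : fpoly := [seq (- t.1, t.2) | t <- f].
Definition fcons (e : edge) (f : fpoly) : fpoly := [seq (t.1, e :: t.2) | t <- f].
Definition fmul (f g : fpoly) : fpoly :=
  flatten [seq [seq (t.1 * u.1, t.2 ++ u.2) | u <- g] | t <- f].
Fixpoint flap (g : nat -> seq nat -> fpoly) (s : seq nat) : fpoly :=
  if s is b :: s' then g b s' ++ fopp (flap (fun x l => g x (b :: l)) s') else [::].
Definition fedge (i j : nat) : edge := if (i < j)%N then (i, j) else (j, i).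
Fixpoint fbc (s t : seq nat) : fpoly :=
  if s is a :: s' then flap (fun b l => fcons (fedge a b) (fbc s' l)) t else [:: (1, [::])].
Fixpoint fbd (m : seq edge) : fpoly :=
  if m is e :: m' then (1, m') :: fopp (fcons e (fbd m')) else [::].


Definition fscale (k : int) (f : fpoly) : fpoly := [seq (k * t.1, t.2) | t <- f].

Definition le_edge (e f : edge) := (e.1 < f.1)%N || ((e.1 == f.1) && (e.2 <= f.2)%N).
Fixpoint insert_edge (e : edge) (m : seq edge) : bool * seq edge :=
  if m is f :: m' then
    if le_edge e f then (false, e :: m)
    else let: (b, k) := insert_edge e m' in (~~ b, f :: k)
  else (false, [:: e]).
Fixpoint sort_mono (m : seq edge) : bool * seq edge :=
  if m is e :: m' then
    let: (b, k) := sort_mono m' in let: (b', k') := insert_edge e k in (b (+) b', k')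
  else (false, [::]).
Definition norm_term (t : int * seq edge) :=
  let: (b, k) := sort_mono t.2 in (if b then - t.1 else t.1, k).
Fixpoint le_mono (m n : seq edge) :=
  match m, n with
  | [::], _ => true
  | _, [::] => false
  | e :: m', f :: n' => if e == f then le_mono m' n' else le_edge e f
  end.
Fixpoint collect (f : fpoly) : fpoly :=
  if f is (c, m) :: f' then
    match collect f' with
    | (c', m') :: g => if m == m' then (c + c', m) :: g else (c, m) :: (c', m') :: g
    | [::] => [:: (c, m)]
    end
  else [::].
(** A normal form test on words of pairs of numbers: sort each word and record the sign, sort the
    terms, then merge equal words. It runs by computation, which finite sets and chains would block;
    [eval_zero] transfers the outcome to chains. *)
Definition is_zero (f : fpoly) :=
  all (fun t => t.1 == 0)
      (collect (sort (fun t u => le_mono t.2 u.2) (map norm_term f))).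

(** * Evaluation of formal polynomials as chains *)

Section Eval.
Variables (T : finType) (v : nat -> T).

Definition epath (e : edge) : chain {set T} := pt [set v e.1; v e.2].
Definition emono (m : seq edge) : chain {set T} := \prod_(e <- m) epath e.
Definition eval (f : fpoly) : chain {set T} := \sum_(t <- f) emono t.2 *~ t.1.

Lemma eval_cons t f : eval (t :: f) = emono t.2 *~ t.1 + eval f.
Proof. exact: big_cons. Qed.

Lemma eval_cat f g : eval (f ++ g) = eval f + eval g.
Proof. exact: big_cat. Qed.

Lemma eval_opp f : eval (fopp f) = - eval f.
Proof. by rewrite /eval big_map -sumrN; apply: eq_bigr => t _; rewrite mulrNz. Qed.

Lemma eval_scale k f : eval (fscale k f) = eval f *~ k.
Proof.
by rewrite /eval big_map mulrz_suml; apply: eq_bigr => t _; rewrite /= mulrC mulrzA.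
Qed.

Lemma eval_flatten fs : eval (flatten fs) = \sum_(f <- fs) eval f.
Proof.
elim: fs => [|f fs IH]; first by rewrite /eval !big_nil.
by rewrite big_cons /= eval_cat IH.
Qed.

Lemma eval_cons_edge e f : eval (fcons e f) = epath e * eval f.
Proof.
rewrite /eval big_map mulr_sumr; apply: eq_bigr => t _.
by rewrite /emono big_cons; symmetry; apply: mulrzAr.
Qed.

Lemma eval_mul f g : eval (fmul f g) = eval f * eval g.
Proof.
elim: f => [|t f IH]; first by rewrite /eval !big_nil mul0r.
rewrite /fmul /= eval_cat -/(fmul f g) IH eval_cons mulrDl; congr (_ + _).
rewrite /eval big_map mulr_sumr; apply: eq_bigr => u _ /=.
by rewrite /emono big_cat /= mulrzA [RHS]mulrzAr mulrzAl.
Qed.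

Lemma eval_edge i j : epath (fedge i j) = pt [set v i; v j].
Proof. by rewrite /fedge /epath; case: ltnP => // _; rewrite setUC. Qed.

Lemma eval_lap g s (h : T -> seq T -> chain {set T}) :
  (forall x l, eval (g x l) = h (v x) (map v l)) -> eval (flap g s) = lap h (map v s).
Proof.
elim: s g h => [|b s IH] g h E /=; first exact: big_nil.
rewrite eval_cat eval_opp E; congr (_ - _).
by apply: IH => x l; rewrite E.
Qed.

Lemma eval_bc s t : eval (fbc s t) = bc (map v s) (map v t).
Proof.
elim: s t => [|a s IH] t /=; first by rewrite /eval big_seq1 /emono big_nil.
by apply: eval_lap => x l; rewrite eval_cons_edge eval_edge IH.
Qed.

Lemma eval_bd m : eval (fbd m) = bd (emono m).
Proof.
elim: m => [|e m IH]; first by rewrite /eval /emono !big_nil bd1.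
by rewrite /emono big_cons bd_ptM eval_cons eval_opp eval_cons_edge IH.
Qed.

Lemma emono_insert e m :
  epath e * emono m = emono (insert_edge e m).2 *~ (-1) ^+ (insert_edge e m).1.
Proof.
elim: m => [|f m IH] /=; first by rewrite /emono big_nil big_seq1 mulr1 expr0 mulr1z.
case: ifP => _; first by rewrite expr0 mulr1z [RHS]/emono big_cons.
case E: (insert_edge e m) IH => [b k] /= IH.
rewrite /emono !big_cons mulrA [_ * epath f]ptC mulNr -mulrA IH.
rewrite signrN mulrNz; congr (- _); exact: mulrzAr.
Qed.

Lemma emono_sort m : emono m = emono (sort_mono m).2 *~ (-1) ^+ (sort_mono m).1.
Proof.
elim: m => [|e m IH] /=; first by rewrite expr0.
case E: (sort_mono m) IH => [b k] /= IH.
have := emono_insert e k; case: (insert_edge e k) => b' k' /= H.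
rewrite [LHS]/emono big_cons -/(emono m) IH signr_addb mulrC mulrzA -H.
exact: mulrzAr.
Qed.

Lemma eval_norm f : eval (map norm_term f) = eval f.
Proof.
rewrite /eval big_map; apply: eq_bigr => -[c m] _ /=.
rewrite [in RHS]emono_sort /norm_term /=; case: (sort_mono m) => b k /=.
by rewrite -mulrzA; case: b; rewrite /= ?mulN1r ?mul1r.
Qed.

Lemma eval_collect f : eval (collect f) = eval f.
Proof.
elim: f => [|[c m] f IH] //=; rewrite eval_cons -IH.
case: (collect f) => [|[c' m'] g]; first by rewrite eval_cons.
case: eqP => [->|_]; last by rewrite eval_cons.
by rewrite !eval_cons /= mulrzDr addrA.
Qed.

Lemma eval_zero f : is_zero f -> eval f = 0.
Proof.
move=> /allP h; rewrite -eval_norm.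
have <- : eval (sort (fun t u => le_mono t.2 u.2) (map norm_term f)) = eval (map norm_term f).
  by apply: perm_big; rewrite perm_sort.
rewrite -eval_collect /eval big_seq big1 // => t /h /eqP->; exact: mulr0z.
Qed.

End Eval.

Definition or_Bd (T : finType) (S : {set T}) r (H : chain {set T} -> Prop) x := Bd S r x \/ H x.

(** These are the products of type [1,0] with a cycle on the remaining vertices, the factor [1,0]
    being a multiple of the empty simplex on the vertex [c]. *)
Definition free_at (T : finType) (S : {set T}) r (x : chain {set T}) :=
  exists2 c, c \in S & x \in Cy (S :\ c) r.

(* A certificate expresses a multiple of a chain as a combination of products of two
   chessboard cycles plus the boundary of a combination of matchings. *)
Definition cycle_pair := (seq nat * seq nat * (seq nat * seq nat))%type.
Definition fpair (g : cycle_pair) : fpoly := fmul (fbc g.1.1 g.1.2) (fbc g.2.1 g.2.2).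
Definition mono_support (m : seq edge) := flatten [seq [:: e.1; e.2] | e <- m].
Definition valid_certificate (k : nat) (f : fpoly) (gs : seq (int * cycle_pair)) (ts : seq (int * seq edge)) :=
  is_zero (fscale k%:Z f ++ fopp (flatten [seq fscale t.1 (fpair t.2) | t <- gs]
    ++ flatten [seq fscale t.1 (fbd t.2) | t <- ts])).
Definition bounded_uniq n (s : seq nat) := uniq s && all (fun i => (i < n)%N) s.

Section Certificates.
Variable T : finType.
Implicit Types (S U W : {set T}) (D : pred nat).

Lemma emono_Ch (v : nat -> T) m : uniq (map v (mono_support m)) ->
  emono v m \in Ch [set x in map v (mono_support m)] (size m).
Proof.
elim: m => [|[i j] m IH] /=; first by rewrite /emono big_nil Ch1.
rewrite inE negb_or => /andP[/andP[nij hi] /andP[hj /IH hm]].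
rewrite /emono big_cons -add1n.
apply: (@Ch_sub _ ([set v i; v j] :|: [set x in map v (mono_support m)])).
  by apply/subsetP => x; rewrite !inE orbA.
apply: ChM => //; last by rewrite Ch_pt ?inE ?eqxx ?orbT.
rewrite disjoint_subset; apply/subsetP => x; rewrite !inE.
by case/orP=> /eqP->.
Qed.

Lemma hull_certificate D (H : chain {set T} -> Prop) (vs : seq T) k f gs ts r x0 :
  uniq vs -> D k -> valid_certificate k f gs ts ->
  all (fun t => bounded_uniq (size vs) (mono_support t.2) && (size t.2 == r.+1)) ts ->
  (forall x, Bd [set x in vs] r x -> hull D H x) ->
  (forall s1 t1 s2 t2, (s1, t1, (s2, t2)) \in map snd gs ->
     hull D H (bc (map (nth x0 vs) s1) (map (nth x0 vs) t1) *
               bc (map (nth x0 vs) s2) (map (nth x0 vs) t2))) ->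
  hull D H (eval (nth x0 vs) f).
Proof.
move=> uvs Dk /(eval_zero (nth x0 vs)); set v := nth x0 vs => E hts hBd hgs.
apply: (hull_div Dk).
have -> : eval v f *+ k = eval v (flatten [seq fscale t.1 (fpair t.2) | t <- gs])
    + eval v (flatten [seq fscale t.1 (fbd t.2) | t <- ts]).
  apply/eqP; rewrite -subr_eq0 -eval_cat -eval_opp -[_ *+ k]/(_ *~ k%:Z) -eval_scale -eval_cat.
  exact/eqP.
rewrite !eval_flatten !big_map; apply: hullD.
  rewrite big_seq; apply: big_ind; [exact: hull0|by move=> *; apply: hullD|].
  move=> [c [[s1 t1] [s2 t2]]] hg; rewrite eval_scale eval_mul !eval_bc; apply: hullMz.
  by apply: hgs; apply/mapP; exists (c, (s1, t1, (s2, t2))).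
apply: hBd; exists (\sum_(t <- ts) emono v t.2 *~ t.1).
  rewrite big_seq; apply: rpred_sum => -[c m] /(allP hts) /= /andP[/andP[um bm] /eqP <-].
  apply: rpredMz; apply: (@Ch_sub _ [set x in map v (mono_support m)]).
    apply/subsetP => x; rewrite !inE => /mapP[i /(allP bm) hi ->].
    exact: mem_nth.
  apply: emono_Ch; rewrite map_inj_in_uniq // => i j /(allP bm) hi /(allP bm) hj /eqP.
  by rewrite nth_uniq // => /eqP.
rewrite bd_sum; apply: eq_bigr => t _; by rewrite eval_scale eval_bd raddfMz.
Qed.

End Certificates.

Section Relations.
Variable T : finType.
Implicit Types (S U W : {set T}) (D : pred nat) (y z : chain {set T}).

Definition is_hex U z := exists s t : seq T,
  [/\ uniq (s ++ t), size s = 2%N, size t = 3%N, U = [set x in s ++ t] & z = bc s t].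

Lemma hex_Cy U z : is_hex U z -> z \in Cy U 2.
Proof. by move=> [s [t [us hs ht -> ->]]]; rewrite -hs; apply: Cy_bc; rewrite // hs ht. Qed.

Lemma uniq_map_nth (vs : seq T) x0 s : uniq vs -> bounded_uniq (size vs) s ->
  uniq (map (nth x0 vs) s).
Proof.
move=> uvs /andP[us /allP bs]; rewrite map_inj_in_uniq // => i j /bs hi /bs hj /eqP.
by rewrite nth_uniq // => /eqP.
Qed.

Lemma sub_map_nth (vs : seq T) x0 s : bounded_uniq (size vs) s ->
  [set x in map (nth x0 vs) s] \subset [set x in vs].
Proof.
move=> /andP[_ /allP bs]; apply/subsetP => x; rewrite !inE => /mapP[i /bs hi ->].
exact: mem_nth.
Qed.

(* The certificates below were found by linear algebra, after averaging over the
   symmetries of the left-hand side. *)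
Lemma tri_tri U W y z D : D 6%N -> [disjoint U & W] -> is_tri U y -> is_tri W z ->
  hull D (or_Bd (U :|: W) 2 (free_at (U :|: W) 2)) (y * z).
Proof.
move=> D6 dUW [v [a [b [us EU ->]]]] [w [c [d [ut EW ->]]]].
pose vs := [:: v; a; b; w; c; d].
have uvs : uniq vs.
  rewrite -[vs]/([:: v; a; b] ++ [:: w; c; d]) cat_uniq us ut andbT.
  apply/hasPn => x xW; move: dUW; rewrite disjoint_sym disjoint_subset => /subsetP/(_ x).
  by rewrite EU EW !inE -!orbA; apply; move: xW; rewrite !inE.
have -> : U :|: W = [set x in vs] by apply/setP => x; rewrite EU EW !inE -!orbA.
(* The eight symmetries of the product: exchanging the two ends in either triangle, and exchanging
   the triangles. Each generator changes the sign of the product, which gives the listed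
   coefficients. *)
pose perms : seq (int * seq nat) :=
  [:: (1, [:: 0; 1; 2; 3; 4; 5]%N); (-1, [:: 3; 4; 5; 0; 1; 2]%N);
      (-1, [:: 0; 1; 2; 3; 5; 4]%N); (1, [:: 3; 5; 4; 0; 1; 2]%N);
      (-1, [:: 0; 2; 1; 3; 4; 5]%N); (1, [:: 3; 4; 5; 0; 2; 1]%N);
      (1, [:: 0; 2; 1; 3; 5; 4]%N); (-1, [:: 3; 5; 4; 0; 2; 1]%N)].
(* Origin of the 6, on the matchings that occur in the product: each chessboard contributes two of
   its four terms and each boundary one, so the eight symmetries give four copies from [gs] and two
   from [ts]. All other terms cancel. The chessboard misses the vertex [g 5], which is free. *)
pose gs : seq (int * cycle_pair) := [seq let g := nth 0%N t.2 in
   (- t.1, ([:: g 0; g 4], [:: g 1; g 2; g 3], ([::], [::]))%N) | t <- perms].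
pose ts : seq (int * seq edge) := [seq let g := nth 0%N t.2 in
   (t.1, [:: fedge (g 0) (g 1); fedge (g 2) (g 4); fedge (g 3) (g 5)]%N) | t <- perms].
have -> : tri v a b * tri w c d =
    eval (nth v vs) (fmul (fbc [:: 0] [:: 1; 2]) (fbc [:: 3] [:: 4; 5]))%N.
  by rewrite eval_mul !eval_bc -!bc1.
apply: (@hull_certificate _ _ _ _ 6%N _ gs ts 2) => //.
  by move=> x hx; apply: hull_gen; left.
move=> s1 t1 s2 t2 hg; apply: hull_gen; right.
have : all (fun g : cycle_pair => [&& bounded_uniq 6 (g.1.1 ++ g.1.2), size g.1.1 == 2%N,
    size g.1.2 == 3%N, g.2 == ([::], [::]) & has (fun i => i \notin g.1.1 ++ g.1.2) (iota 0 6)])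
    (map snd gs) by [].
move/allP/(_ _ hg)/and5P => -[bu /eqP hs /eqP ht /eqP[-> ->] /hasP[i]].
rewrite mem_iota => /andP[_ hi] ni; rewrite /= in bu hs ht hi ni *; rewrite mulr1.
exists (nth v vs i); first by rewrite inE mem_nth.
apply: (@Cy_sub _ [set x in map (nth v vs) (s1 ++ t1)]); last first.
  rewrite -hs -(size_map (nth v vs) s1) map_cat; apply: Cy_bc.
    by rewrite -map_cat uniq_map_nth.
  by rewrite !size_map hs ht.
apply/subsetP => x xs; rewrite in_setD1 (subsetP (@sub_map_nth vs v _ bu) _ xs) andbT.
move: xs; rewrite inE => /mapP[j hj ->]; rewrite nth_uniq //.
  by apply: contraNneq ni => <-.
by case/andP: bu => _ /allP; apply.
Qed.

(** On five vertices the matching complex is the Petersen graph. Its hexagons have even length and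
    the pentagon has odd length, so the factor 2 cannot be avoided; the six hexagons used have two
    rows among the first four vertices. *)
Lemma pent_hull_hex U z D : D 2%N -> is_pent U z -> hull D (or_Bd U 2 (is_hex U)) z.
Proof.
move=> D2 [v [w [a [b [c [us -> ->]]]]]].
pose vs := [:: v; w; a; b; c].
pose gs : seq (int * cycle_pair) := [seq (t.1, (t.2, ([::], [::]))) | t <-
  [:: (-1, ([:: 0; 1], [:: 2; 3; 4])%N); (1, ([:: 1; 2], [:: 0; 3; 4])%N);
      (1, ([:: 0; 2], [:: 1; 3; 4])%N); (-1, ([:: 1; 3], [:: 0; 2; 4])%N);
      (-1, ([:: 0; 3], [:: 1; 2; 4])%N); (1, ([:: 2; 3], [:: 0; 1; 4])%N)]].
have -> : pent v w a b c = eval (nth v vs)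
    [seq (1, s) | s <- [:: [:: (0, 2); (1, 3)]; [:: (1, 3); (2, 4)]; [:: (2, 4); (0, 1)];
       [:: (0, 1); (3, 4)]; [:: (3, 4); (0, 2)]]%N].
  by rewrite /eval /= !big_cons big_nil /emono !big_cons !big_nil !mulr1 addr0 !addrA.
(* The identity holds exactly, with no boundary term: five vertices carry no matching with three
   edges. *)
apply: (@hull_certificate _ _ _ _ 2%N _ gs [::] 2) => //.
  by move=> x hx; apply: hull_gen; left.
move=> s1 t1 s2 t2 hg; apply: hull_gen; right.
have : all (fun g : cycle_pair => [&& bounded_uniq 5 (g.1.1 ++ g.1.2), size g.1.1 == 2%N,
    size g.1.2 == 3%N, g.2 == ([::], [::]) & all (fun i => i \in g.1.1 ++ g.1.2) (iota 0 5)])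
    (map snd gs) by [].
move/allP/(_ _ hg)/and5P => -[bu /eqP hs /eqP ht /eqP[-> ->] /allP hi].
rewrite [_.1.1]/= [_.1.2]/= in bu hs ht.
rewrite mulr1; exists (map (nth v vs) s1), (map (nth v vs) t1).
rewrite -map_cat uniq_map_nth // !size_map; split=> //.
apply/eqP; rewrite eqEsubset (@sub_map_nth vs v _ bu) andbT; apply/subsetP => x.
rewrite in_set => xvs; rewrite inE -(nth_index v xvs); apply: map_f; apply: hi.
by rewrite mem_iota; rewrite -index_mem in xvs; exact: xvs.
Qed.

(** The cycles on seven vertices that occur are fundamental cycles of chessboards with three rows
    and four columns. The multiplier 5 makes this relation useless over the integers prime to 5, and
    it is the source of possible classes of order 5. *)
Lemma hex_hex U W y z D : D 5%N -> [disjoint U & W] -> is_hex U y -> is_hex W z ->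
  hull D (or_Bd (U :|: W) 4 (fun x => exists (V : {set T}) y3 y7,
     [/\ V \subset U :|: W, is_tri V y3, y7 \in Cy ((U :|: W) :\: V) 3 & x = y3 * y7]))
   (y * z).
Proof.
move=> D5 dUW [s [t [us hs ht EU ->]]] [s' [t' [us' hs' ht' EW ->]]].
pose vs := (s ++ t) ++ (s' ++ t').
have uvs : uniq vs.
  rewrite cat_uniq us us' andbT /=; apply/hasPn => x xW.
  move: dUW; rewrite disjoint_sym disjoint_subset => /subsetP/(_ x).
  by rewrite EU EW !inE; apply.
have svs : size vs = 10%N by rewrite !size_cat hs ht hs' ht'.
have -> : U :|: W = [set x in vs].
  by apply/setP => x; rewrite EU EW !inE !mem_cat.
(* A side singles out a row [x] of one hexagon, with [y] its other row, [B] its columns and [A] the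
   vertices of the other hexagon; the factor [3,1] joins [x] to two of the columns in [B]. *)
pose sides : seq (seq nat * nat * nat * seq nat) :=
  [:: ([:: 0; 1; 2; 3; 4], 5, 6, [:: 7; 8; 9]); ([:: 0; 1; 2; 3; 4], 6, 5, [:: 7; 8; 9]);
      ([:: 5; 6; 7; 8; 9], 0, 1, [:: 2; 3; 4]); ([:: 5; 6; 7; 8; 9], 1, 0, [:: 2; 3; 4])]%N.
(* Origin of the 5: the terms of the first kind in which [y] is matched to [b 2] add up to one copy
   of the product for each of the four sides, and the boundary of [ts] supplies a fifth. In the
   terms of the second kind [y] is never matched to [b 2]; they help to cancel the rest. *)
pose gs : seq (int * cycle_pair) := flatten [seq let: (A, x, y, B) := u in
    let a := nth 0%N A in
    flatten [seq let b := nth 0%N (rot r B) in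
      (1, ([:: x], [:: b 0; b 1], ([:: a 0; a 1; y], [:: a 2; a 3; a 4; b 2]))%N) ::
      [seq let d := nth 0%N (rot k (drop 2 A)) in
        (-1, ([:: x], [:: b 0; b 1], ([:: a 0; a 1; d 0], [:: d 1; d 2; y; b 2]))%N)
        | k <- iota 0 3]
      | r <- iota 0 3]
    | u <- sides].
pose perm3 (a b c : nat) : seq (int * seq nat) :=
    [:: (1, [:: a; b; c]%N); (1, [:: b; c; a]%N); (1, [:: c; a; b]%N);
        (-1, [:: a; c; b]%N); (-1, [:: b; a; c]%N); (-1, [:: c; b; a]%N)].
(* Each hexagon leaves one column unmatched; these matchings join the two unmatched columns, with
   the product of the signs of both column orders. Deleting the joining edge returns the product of
   the hexagons. *)
pose ts : seq (int * seq edge) := flatten [seq [seq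
      let a := nth 0%N s.2 in let b := nth 0%N t.2 in
      (s.1 * t.1 : int, [:: fedge 0 (a 0); fedge 1 (a 1); fedge (a 2) (b 0);
                      fedge 5 (b 1); fedge 6 (b 2)]%N)
    | t <- perm3 7%N 8%N 9%N] | s <- perm3 2%N 3%N 4%N].
have [x0 Ex0] : exists x0, vs = x0 :: behead vs by case: (vs) svs => // x l _; exists x.
(* Reads off a block of [vs] by its positions, so that the numbers 0 to 9 name the rows and columns
   of the two hexagons in order. *)
have Em (l1 l2 l3 : seq T) : vs = l1 ++ l2 ++ l3 ->
    map (nth x0 vs) (iota (size l1) (size l2)) = l2.
  move=> ->; apply: (@eq_from_nth _ x0); rewrite size_map size_iota // => i hi.
  rewrite (nth_map 0%N) ?size_iota // nth_iota // nth_cat ltnNge leq_addr /= addKn.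
  by rewrite nth_cat hi.
have -> : bc s t * bc s' t' =
    eval (nth x0 vs) (fmul (fbc [:: 0; 1] [:: 2; 3; 4]) (fbc [:: 5; 6] [:: 7; 8; 9]))%N.
  rewrite eval_mul !eval_bc; congr (bc _ _ * bc _ _); symmetry.
  - by have := Em [::] s (t ++ s' ++ t'); rewrite hs; apply; rewrite /vs -catA.
  - by have := Em s t (s' ++ t'); rewrite hs ht; apply; rewrite /vs -catA.
  - by have := Em (s ++ t) s' t'; rewrite size_cat hs ht hs'; apply.
  - by have := Em ((s ++ t) ++ s') t' [::]; rewrite !size_cat hs ht hs' ht' cats0 -catA; apply.
apply: (@hull_certificate _ _ _ _ 5%N _ gs ts 4); [exact: uvs|exact: D5|by vm_compute|..].
- by rewrite svs; vm_compute.
- by move=> x hx; apply: hull_gen; left.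
move=> s1 t1 s2 t2 hg; apply: hull_gen; right.
have : all (fun g : cycle_pair => [&& bounded_uniq 10 ((g.1.1 ++ g.1.2) ++ (g.2.1 ++ g.2.2)),
    size g.1.1 == 1%N, size g.1.2 == 2%N, size g.2.1 == 3%N & size g.2.2 == 4%N])
    (map snd gs) by vm_compute.
move/allP/(_ _ hg)/and5P => -[bu /eqP h0 /eqP h1 /eqP h2 /eqP h3].
rewrite /= in bu h0 h1 h2 h3; case: s1 h0 {hg} bu => [|p []] //= _.
case: t1 h1 => [|p1 [|p2 []]] //= _ bu.
have [bu1 bu2] : bounded_uniq 10 [:: p; p1; p2] /\ bounded_uniq 10 (s2 ++ t2).
  move: bu; rewrite -[[:: p, p1, p2 & s2 ++ t2]]/([:: p; p1; p2] ++ (s2 ++ t2)) => /andP[].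
  by rewrite /bounded_uniq cat_uniq all_cat => /and3P[-> _ ->] /andP[-> ->].
have um : uniq (map (nth x0 vs) ([:: p; p1; p2] ++ (s2 ++ t2))).
  by rewrite uniq_map_nth // svs.
rewrite -svs in bu1 bu2.
exists [set x in map (nth x0 vs) [:: p; p1; p2]], (bc [:: nth x0 vs p] [:: nth x0 vs p1; nth x0 vs p2]).
exists (bc (map (nth x0 vs) s2) (map (nth x0 vs) t2)); split=> //.
- exact: sub_map_nth.
- exists (nth x0 vs p), (nth x0 vs p1), (nth x0 vs p2); split; last exact: bc1.
    exact: (uniq_map_nth x0 uvs bu1).
  by apply/setP => x; rewrite !inE orbA.
rewrite -h2 -(size_map (nth x0 vs)); apply: (@Cy_sub _ [set x in map (nth x0 vs) (s2 ++ t2)]).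
  apply/subsetP => x xs; rewrite in_setD (subsetP (@sub_map_nth vs x0 _ bu2) _ xs) andbT.
  move: um xs; rewrite map_cat cat_uniq inE in_set => /and3P[_ /hasPn h _]; exact: h.
rewrite map_cat; apply: Cy_bc; last by rewrite !size_map h2 h3.
by have := um => /= /and4P[_ _ _]; rewrite map_cat.
Qed.

End Relations.

(** * Generation away from 5 *)

Section Generators.
Variable T : finType.
Implicit Types (S U W : {set T}) (D : pred nat) (x y z : chain {set T}).

Lemma tri_card U z : is_tri U z -> #|U| = 3%N.
Proof.
move=> [v [a [b [us -> _]]]]; have -> : [set v; a; b] = [set x in [:: v; a; b]].
  by apply/setP => x; rewrite !inE orbA.
by rewrite cardsE (card_uniqP us).
Qed.

Lemma pent_card U z : is_pent U z -> #|U| = 5%N.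
Proof. by move=> [v [w [a [b [c [us -> _]]]]]]; rewrite cardsE (card_uniqP us). Qed.

Lemma setU_D U S : U \subset S -> U :|: S :\: U = S.
Proof. by move=> US; rewrite setDE setUIr setUCr setIT; apply/setUidPr. Qed.

(** The three reduction hypotheses concern cycles of weight one less (after a triangle), of the same
    weight (after a pentagon) and of weight two more (on four vertices less); the last kind needs
    only to be generated by boundaries and cycles with a free vertex. *)
Lemma hull_generation D (G : chain {set T} -> Prop) S r z :
  mul_closed D -> (1 < #|S|)%N -> (forall x, Bd S r x -> hull D G x) ->
  (forall r' U y s, r = r'.+1 -> U \subset S -> is_tri U y -> s \in Cy (S :\: U) r' ->
     hull D G (y * s)) ->
  (forall r' U y s, r = r'.+2 -> U \subset S -> is_pent U y -> s \in Cy (S :\: U) r' ->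
     hull D G (y * s)) ->
  (forall r' S' x, r = r'.+2 -> S' \subset S -> (#|S'| + 4)%N = #|S| -> x \in Cy S' r' ->
     hull D (or_Bd S' r' (free_at S' r')) x) ->
  z \in Cy S r -> hull D G z.
Proof.
move=> hD S1 hBd htri hpent hfour; have [v1 [v2 [v1S v2S n12]]] := card_gt1P S1.
apply: (hull_peel v1S v2S n12 hBd).
- move=> r' a s rE; rewrite !inE => /and3P[a2 a1 aS] hs.
  have hU v w : v != w -> a != v -> a != w -> v \in S -> w \in S ->
      S :\: [set v; a; w] = S :\ v1 :\ v2 :\ a -> hull D G (tri v a w * s).
    move=> nvw nav naw vS wS E; apply: (htri r' [set v; a; w]) => //.
    - by apply/subsetP => t; rewrite !inE => /orP[/orP[]|] /eqP->.
    - by exists v, a, w; rewrite /= !inE negb_or nvw naw eq_sym nav.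
    - by rewrite E.
  split; apply: hU; rewrite // 1?eq_sym //; apply/setP => t; rewrite !inE !negb_or;
    by case: (t == v1); case: (t == v2); case: (t == a).
- move=> r' a b x rE aB bB nab hx.
  apply: (liftable_hull v1S v2S n12 hBd hD rE aB bB nab).
    by move=> U y s US hy hs; apply: (hpent r' U).
  have BS : S :\ v1 :\ v2 :\ a :\ b \subset S.
    by rewrite !(subset_trans (subsetDl _ _)) // subsetDl.
  apply: (hull_trans _ (hfour r' _ x rE BS _ hx)) => [y [h|[c cB h]]|].
  - by apply: hull_gen; left.
  - by apply: hull_gen; right; exists c.
  have := cardsD1 v1 S; rewrite v1S (cardsD1 v2 (S :\ v1)) !inE eq_sym n12 v2S.
  rewrite (cardsD1 a (S :\ v1 :\ v2)) aB (cardsD1 b (_ :\ a)) !inE eq_sym nab /=.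
  by have := bB; rewrite !inE => -> ->; rewrite addnC.
Qed.

Lemma hull_mull D (H G : chain {set T} -> Prop) S U r1 r2 d x :
  U \subset S -> d \in Cy U r1 -> hull D (or_Bd (S :\: U) r2 H) x ->
  (forall y, Bd S (r1 + r2) y -> hull D G y) -> (forall g, H g -> hull D G (d * g)) ->
  hull D G (d * x).
Proof.
move=> US hd hx hBd hH.
apply: (hull_map (f := fun x => d * x)) hx => [c c'|g [hg|]]; last exact: hH.
  by rewrite mulrBr.
by apply: hBd; rewrite -(setU_D US); apply: BdMl hg => //; apply: disjointD.
Qed.

Lemma hull_mulr D (H G : chain {set T} -> Prop) S U r1 r2 d x :
  U \subset S -> hull D (or_Bd U r1 H) x -> d \in Cy (S :\: U) r2 ->
  (forall y, Bd S (r1 + r2) y -> hull D G y) -> (forall g, H g -> hull D G (g * d)) ->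
  hull D G (x * d).
Proof.
move=> US hx hd hBd hH.
apply: (hull_map (f := fun x => x * d)) hx => [c c'|g [hg|]]; last exact: hH.
  by rewrite mulrBl.
by apply: hBd; rewrite -(setU_D US); apply: BdMr hg hd; apply: disjointD.
Qed.

Lemma CyM_sub S U r1 r2 c d : U \subset S -> c \in Cy U r1 -> d \in Cy (S :\: U) r2 ->
  c * d \in Cy S (r1 + r2).
Proof. by move=> US hc hd; rewrite -(setU_D US); apply: CyM => //; apply: disjointD. Qed.

Lemma Cy3_hull D S z : mul_closed D -> #|S| = 3%N -> z \in Cy S 1 ->
  hull D (or_Bd S 1 (is_tri S)) z.
Proof.
move=> hD S3; apply: hull_generation; rewrite ?S3 //.
- by move=> x hx; apply: hull_gen; left.
- move=> r' U y s [<-] US hy hs.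
  have SU : S = U by apply/eqP; rewrite eq_sym eqEcard US S3 (tri_card hy).
  rewrite (Ch0E (Cy_Ch hs)) mulrzAr mulr1; apply: hullMz; apply: hull_gen.
  by right; rewrite SU.
Qed.

Lemma Cy2_hull D S z : mul_closed D -> #|S| = 2%N -> z \in Cy S 1 -> hull D (Bd S 1) z.
Proof.
move=> hD S2; apply: hull_generation; rewrite ?S2 //.
- by move=> x hx; apply: hull_gen.
- move=> r' U y s _ /subset_leq_card; rewrite S2 => h /tri_card hU.
  by rewrite hU in h.
Qed.

(** A triangle leaves two vertices, on which a cycle with one edge bounds; a double link is a
    multiple of the empty simplex on one vertex, which is free. Only pentagons remain. *)
Lemma Cy5_hull D S z : mul_closed D -> D 2%N -> #|S| = 5%N -> z \in Cy S 2 ->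
  hull D (or_Bd S 2 (is_hex S)) z.
Proof.
move=> hD D2 S5; apply: hull_generation; rewrite ?S5 //.
- by move=> x hx; apply: hull_gen; left.
- move=> r' U y s [<-] US hy hs.
  have c2 : #|S :\: U| = 2%N by rewrite cardsDS // S5 (tri_card hy).
  apply: (hull_mull (r1 := 1) (r2 := 1) (H := fun=> False) US (tri_Cy hy)) => //.
    by apply: hull_trans (Cy2_hull hD c2 hs) => g hg; apply: hull_gen; left.
  by move=> x hx; apply: hull_gen; left.
- move=> r' U y s [<-] US hy hs.
  have SU : S = U by apply/eqP; rewrite eq_sym eqEcard US S5 (pent_card hy).
  rewrite (Ch0E (Cy_Ch hs)) mulrzAr mulr1; apply: hullMz; rewrite SU.
  exact: pent_hull_hex.
- move=> r' S' x [<-] S'S /eqP; rewrite (eqn_add2r 4 _ 1) => /eqP c1 hx.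
  have [c cS] : exists c, c \in S' by apply/set0Pn; rewrite -card_gt0 c1.
  apply: hull_gen; right; exists c => //.
  have [h1 h2] := CyP _ _ _ hx; rewrite (Ch0E h1); apply: rpredMz; exact: Cy1.
Qed.

Lemma Cy3_mul_hull D S U y z : mul_closed D -> D 6%N -> U \subset S ->
  #|U| = 3%N -> #|S :\: U| = 3%N -> y \in Cy U 1 -> z \in Cy (S :\: U) 1 ->
  hull D (or_Bd S 2 (free_at S 2)) (y * z).
Proof.
move=> hD D6 US U3 W3 hy hz.
have hBd x : Bd S (1 + 1) x -> hull D (or_Bd S 2 (free_at S 2)) x.
  by move=> h; apply: hull_gen; left.
apply: (hull_mull US hy (Cy3_hull hD W3 hz)) => // g hg.
apply: (hull_mulr US (Cy3_hull hD U3 hy) (tri_Cy hg)) => // h hh.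
rewrite -{1 2}(setU_D US); apply: tri_tri => //; exact: disjointD.
Qed.

End Generators.

Section Generation.
Variable T : finType.
Implicit Types (S U W : {set T}) (D : pred nat) (y z : chain {set T}).

(** The types [1,0], [3,1], [5,2] all have the form [2k + 1, k], so a list of the numbers k encodes
    a product type. *)
Fixpoint prod_type (ks : seq nat) S z : Prop :=
  if ks is k :: ks' then exists U y z', [/\ U \subset S, #|U| = k.*2.+1, y \in Cy U k,
    prod_type ks' (S :\: U) z' & z = y * z'] else S = set0 /\ z = 1.

Lemma prod_Cy ks S z : prod_type ks S z -> z \in Cy S (sumn ks).
Proof.
elim: ks S z => [|k ks IH] S z /=; first by move=> [_ ->]; apply: Cy1.
by move=> [U [y [z' [US _ hy /IH hz ->]]]]; apply: CyM_sub hy hz.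
Qed.

(** The sign of the exchange is absorbed into one of the two cycles. *)
Lemma prod_swap k l ks S z : prod_type [:: k, l & ks] S z -> prod_type [:: l, k & ks] S z.
Proof.
move=> [U [y [_ [US U1 hy [W [x [w [WS W1 hx hw ->]]] ->]]]]].
have WS' : W \subset S by apply: subset_trans WS (subsetDl _ _).
have UW : S :\: U :\: W = S :\: W :\: U by rewrite !setDDl setUC.
exists W, x, ((y *~ (-1) ^+ (k * l)) * w); split=> //.
  exists U, (y *~ (-1) ^+ (k * l)), w; split; rewrite -?UW ?rpredMz //.
  rewrite subsetD US disjoint_sym; move: WS; rewrite subsetD => /andP[_].
  by rewrite disjoint_sym.
by rewrite !mulrA (ChC (Cy_Ch hy) (Cy_Ch hx)) mulrzAr.
Qed.

Lemma prod_cons k ks ls S z : (forall S' z', prod_type ks S' z' -> prod_type ls S' z') ->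
  prod_type (k :: ks) S z -> prod_type (k :: ls) S z.
Proof. by move=> h [U [y [z' [US Uk hy /h hz ->]]]]; exists U, y, z'. Qed.

Lemma prod_free ks S z : prod_type (0%N :: ks) S z -> free_at S (sumn ks) z.
Proof.
move=> [U [y [w [US /eqP/cards1P[c Ec] hy /prod_Cy hw ->]]]].
exists c; first by apply: (subsetP US); rewrite Ec inE.
by rewrite (Ch0E (Cy_Ch hy)) mulrzAl mul1r rpredMz // -Ec.
Qed.

Definition tri_times S r z := exists U y s,
  [/\ U \subset S, #|U| = 3%N, y \in Cy U 1, s \in Cy (S :\: U) r & z = y * s].

(** Each factor leaves a vertex free, and an edge joins the two. *)
Lemma free_mul_Bd S U r1 r2 w z : U \subset S -> free_at U r1 w -> free_at (S :\: U) r2 z ->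
  Bd S (r1 + r2) (w * z).
Proof.
move=> US [c cU hw] [d dU hz].
have ncd : c != d by apply/eqP => E; move: dU; rewrite -E inE cU.
apply: (Bd_two_free ncd); first exact: (subsetP US).
  by move: dU; rewrite inE => /andP[].
apply: (@Cy_sub _ ((U :\ c) :|: (S :\: U :\ d))).
  apply/subsetP => x; rewrite !inE.
  case/orP => [/andP[nxc xU]|/and3P[nxd nxU xS]].
    rewrite nxc (subsetP US) //= andbT; apply/eqP => E.
    by move: dU; rewrite -E inE xU.
  by rewrite nxd xS andbT /=; apply/eqP => E; move: nxU; rewrite E cU.
apply: CyM hw hz; apply: disjointWl (subsetDl _ _) _.
exact: disjointWr (subsetDl _ _) (disjointD _ _).
Qed.

(** Two factors [3,1] may be traded for a cycle with a free vertex among their six vertices. *)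
Lemma tri_tri_mul_hull D (G : chain {set T} -> Prop) S U W y z w r :
  mul_closed D -> D 6%N -> U \subset S -> #|U| = 3%N -> y \in Cy U 1 ->
  W \subset S :\: U -> #|W| = 3%N -> z \in Cy W 1 -> w \in Cy (S :\: U :\: W) r ->
  (forall x, Bd S (2 + r) x -> hull D G x) ->
  (forall x, free_at (U :|: W) 2 x -> hull D G (x * w)) -> hull D G (y * (z * w)).
Proof.
move=> hD D6 US U3 hy WS W3 hz hw hBd hfree; rewrite mulrA.
have VS : U :|: W \subset S by rewrite subUset US (subset_trans WS (subsetDl _ _)).
have VU : (U :|: W) :\: U = W.
  rewrite setDUl setDv set0U; apply/setDidPl.
  by move: WS; rewrite subsetD => /andP[].
apply: (hull_mulr (r1 := 2) (r2 := r) VS _ _ hBd hfree); last by rewrite -setDDl.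
by apply: (Cy3_mul_hull hD D6 _ U3); rewrite ?VU ?subsetUl.
Qed.

(* The weights 2 #|S| - 5 r >= 4, = 1, = 2 and = 3. *)
Lemma matching_generation D (n : nat) S : mul_closed D -> D 6%N -> #|S| = n ->
  [/\ forall r z, (5 * r + 4 <= 2 * #|S|)%N -> z \in Cy S r -> hull D (Bd S r) z,
      forall q z, #|S| = (5 * q + 3)%N -> z \in Cy S (2 * q + 1) ->
        hull D (or_Bd S (2 * q + 1) (tri_times S (2 * q))) z,
      forall q z, #|S| = (5 * q + 1)%N -> z \in Cy S (2 * q) ->
        hull D (or_Bd S (2 * q) (prod_type (0 :: nseq q 2) S)) z
    & forall q z, #|S| = (5 * q + 4)%N -> z \in Cy S (2 * q + 1) ->
        hull D (or_Bd S (2 * q + 1) (prod_type (0 :: 1 :: nseq q 2)%N S)) z].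
Proof.
move=> hD D6; have [m] := ubnP n; elim: m n S => // m IHm n S nm Sn.
have IH S' : (#|S'| < #|S|)%N -> _ :=
  fun h => IHm #|S'| S' (leq_trans h (etrans (congr1 (fun k => k < m.+1)%N Sn) nm)) erefl.
have small r : (5 * r + 4 <= 2 * #|S|)%N -> (1 < #|S|)%N by lia.
have IHv S' r z : (#|S'| < #|S|)%N -> (5 * r + 4 <= 2 * #|S'|)%N -> z \in Cy S' r ->
  hull D (Bd S' r) z by move=> /IH[h _ _ _]; apply: h.
have IH1 S' q z : (#|S'| < #|S|)%N -> #|S'| = (5 * q + 3)%N -> z \in Cy S' (2 * q + 1) ->
  hull D (or_Bd S' (2 * q + 1) (tri_times S' (2 * q))) z by move=> /IH[_ h _ _]; apply: h.
have IH2 S' q z : (#|S'| < #|S|)%N -> #|S'| = (5 * q + 1)%N -> z \in Cy S' (2 * q) ->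
  hull D (or_Bd S' (2 * q) (prod_type (0 :: nseq q 2) S')) z
  by move=> /IH[_ _ h _]; apply: h.
have IH3 S' q z : (#|S'| < #|S|)%N -> #|S'| = (5 * q + 4)%N -> z \in Cy S' (2 * q + 1) ->
  hull D (or_Bd S' (2 * q + 1) (prod_type (0 :: 1 :: nseq q 2)%N S')) z
  by move=> /IH[_ _ _ h]; apply: h.
have cD U : U \subset S -> #|S :\: U| = (#|S| - #|U|)%N by exact: cardsDS.
have cU U : U \subset S -> (#|U| <= #|S|)%N by exact: subset_leq_card.
have orBd r H x : Bd S r x -> hull D (or_Bd S r H) x by move=> h; apply: hull_gen; left.
split.
- move=> r z hr; apply: hull_generation => //; first exact: small hr.
  + by move=> x hx; apply: hull_gen.
  + move=> r' U y s rE US hy hs; rewrite rE.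
    have [Uc Sc] := (tri_card hy, cD U US).
    have [big|odd_case] := boolP (5 * r' + 4 <= 2 * #|S :\: U|)%N.
      apply: (hull_mull (r1 := 1) (r2 := r') (H := fun=> False) US (tri_Cy hy)) => // [|x hx].
        by apply: hull_trans (IHv _ _ _ _ big hs) => [g hg|]; [apply: hull_gen; left|lia].
      exact: hull_gen.
    (* The factor [s] has weight at least 3; the case left here is weight exactly 3, which forces
       [r'] to be odd. *)
    have [q [qE nE]] : exists q, r' = (2 * q + 1)%N /\ #|S :\: U| = (5 * q + 4)%N.
      by exists (r' %/ 2)%N; lia.
    rewrite qE in hs *.
    apply: (hull_mull (r1 := 1) US (tri_Cy hy) (IH3 _ _ _ _ nE hs)) => [|x hx|g hg].
    * by lia.
    * exact: hull_gen.
    (* The triangle and the factor [3,1] of [g] give one free vertex, the factor [1,0] of [g] a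
       second one, so the product bounds. *)
    have [W [x [w [WS W3 hx hw ->]]]] := prod_swap hg.
    have {}hw : prod_type (0 :: nseq q 2)%N (S :\: U :\: W) w := hw.
    apply: (tri_tri_mul_hull hD D6 US Uc (tri_Cy hy) WS W3 hx (prod_Cy hw)) => [v|v hv].
      by rewrite /= sumn_nseq addnA => h; apply: hull_gen; congr (Bd _ _ _): h; lia.
    have VS : U :|: W \subset S by rewrite subUset US (subset_trans WS (subsetDl _ _)).
    have h := prod_free hw; rewrite setDDl in h.
    have := free_mul_Bd VS hv h; rewrite /= sumn_nseq => h'.
    by apply: hull_gen; congr (Bd _ _ _): h'; lia.
  + move=> r' U y s rE US hy hs; rewrite rE.
    have [Uc Sc] := (pent_card hy, cD U US).
    apply: (hull_mull (r1 := 2) (r2 := r') (H := fun=> False) US (pent_Cy hy)) => // [|x hx].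
      apply: hull_trans (IHv _ _ _ _ _ hs) => [g hg||]; [by apply: hull_gen; left|lia|lia].
    exact: hull_gen.
  + move=> r' S' x rE S'S c4 hx; apply: hull_trans (IHv _ _ _ _ _ hx) => [g hg||]; try lia.
    by apply: hull_gen; left.
- move=> q z Sq; apply: hull_generation => //; first lia; first exact: orBd.
  + move=> r' U y s rE US hy hs; have rq : r' = (2 * q)%N by lia.
    apply: hull_gen; right; exists U, y, s.
    by split; rewrite -?rq ?(tri_card hy) //; apply: tri_Cy.
  + move=> r' U y s rE US hy hs.
    have [[Uc Sc] US'] := (pent_card hy, cD U US, cU U US).
    have [p qE] : exists p, q = p.+1 by exists q.-1; lia.
    have r'E : r' = (2 * p + 1)%N by lia.
    rewrite r'E in hs.
    have -> : (2 * q + 1 = 2 + (2 * p + 1))%N by lia.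
    apply: (hull_mull (r1 := 2) US (pent_Cy hy) (IH1 _ _ _ _ _ hs)); [lia|lia|exact: orBd|].
    move=> g [W [x [w [WS W3 hx hw ->]]]]; apply: hull_gen; right.
    have WS' : W \subset S by apply: subset_trans WS (subsetDl _ _).
    have UW : S :\: U :\: W = S :\: W :\: U by rewrite !setDDl setUC.
    have UsW : U \subset S :\: W.
      rewrite subsetD US disjoint_sym; move: WS; rewrite subsetD => /andP[_].
      by rewrite disjoint_sym.
    exists W, x, (y * w); split=> //.
      have -> : (2 * q = 2 + 2 * p)%N by lia.
      by apply: CyM_sub UsW (pent_Cy hy) _; rewrite -UW.
    by rewrite !mulrA (ChC (Cy_Ch (pent_Cy hy)) (Cy_Ch hx)) mulr1z.
  + move=> r' S' x rE S'S c4 hx.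
    have [p qE] : exists p, q = p.+1 by exists q.-1; lia.
    have r'E : r' = (2 * p + 1)%N by lia.
    rewrite r'E in hx *.
    apply: hull_trans (IH3 _ _ _ _ _ hx) => [g [hg|hg]||]; try lia.
      by apply: hull_gen; left.
    (* On four vertices less the weight is 3, where the generators come with a factor [1,0] and
       hence a free vertex. *)
    apply: hull_gen; right; have := prod_free hg.
    by rewrite /= sumn_nseq; congr free_at; lia.
- case=> [|p] z Sq hz.
    rewrite muln0 in Sq hz *; apply: hull_gen; right.
    by exists S, z, 1; rewrite setDv mulr1.
  move: hz; apply: hull_generation => //; first lia; first exact: orBd.
  + move=> r' U y s rE US hy hs; have rq : r' = (2 * p + 1)%N by lia.
    have [[Uc Sc] US'] := (tri_card hy, cD U US, cU U US).
    rewrite rq in hs; have -> : (2 * p.+1 = 1 + (2 * p + 1))%N by lia.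
    apply: (hull_mull (r1 := 1) US (tri_Cy hy) (IH1 _ _ _ _ _ hs)); [lia|lia|exact: orBd|].
    move=> g [W [x [w [WS W3 hx hw ->]]]].
    apply: (tri_tri_mul_hull hD D6 US Uc (tri_Cy hy) WS W3 hx hw) => [v|v [c cV hv]].
      by move=> h; apply: orBd; congr (Bd _ _ _): h; lia.
    have dUW : [disjoint U & W].
      (* From here on the free vertex [c] is handed over to [w]: the other five vertices carry a
         factor [5,2], and [w] on its own vertices together with [c] has weight 2, so the induction
         applies to it. *)
      by rewrite disjoint_sym; move: WS; rewrite subsetD => /andP[].
    have V6 : #|U :|: W| = 6%N by rewrite cardsU disjoint_setI0 // cards0 Uc W3.
    have VS : (U :|: W) :\ c \subset S.
      apply: subset_trans (subsetDl _ _) _.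
      by rewrite subUset US (subset_trans WS (subsetDl _ _)).
    have V5 : #|(U :|: W) :\ c| = 5%N.
      by apply/eqP; rewrite -eqSS -V6 (cardsD1 c (U :|: W)) cV.
    have S5 := cD _ VS.
    have hw' : w \in Cy (S :\: ((U :|: W) :\ c)) (2 * p).
      apply: Cy_sub hw; rewrite setDDl; apply: setDS; exact: subsetDl.
    have -> : (1 + (2 * p + 1) = 2 + 2 * p)%N by lia.
    apply: (hull_mull (r1 := 2) VS hv (IH2 _ _ _ _ _ hw')); [lia|lia|exact: orBd|].
    move=> g' hg'; apply: hull_gen; right; apply: prod_swap.
    by exists ((U :|: W) :\ c), v, g'.
  + move=> r' U y s rE US hy hs; have rq : r' = (2 * p)%N by lia.
    have [[Uc Sc] US'] := (pent_card hy, cD U US, cU U US).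
    rewrite rq in hs; have -> : (2 * p.+1 = 2 + 2 * p)%N by lia.
    apply: (hull_mull (r1 := 2) US (pent_Cy hy) (IH2 _ _ _ _ _ hs)); [lia|lia|exact: orBd|].
    move=> g' hg'; apply: hull_gen; right; apply: prod_swap.
    by exists U, y, g'; split=> //; apply: pent_Cy.
  move=> r' S' x rE S'S c4 hx; apply: hull_trans (IHv _ _ _ _ _ hx) => [g hg||]; try lia.
  by apply: hull_gen; left.
move=> q z Sq; apply: hull_generation => //; first lia; first exact: orBd.
- move=> r' U y s rE US hy hs; have rq : r' = (2 * q)%N by lia.
  have [[Uc Sc] US'] := (tri_card hy, cD U US, cU U US).
  rewrite rq in hs; have -> : (2 * q + 1 = 1 + 2 * q)%N by lia.
  apply: (hull_mull (r1 := 1) US (tri_Cy hy) (IH2 _ _ _ _ _ hs)); [lia|lia|exact: orBd|].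
  move=> g hg; apply: hull_gen; right; apply: prod_swap.
  by exists U, y, g; split=> //; apply: tri_Cy.
- move=> r' U y s rE US hy hs.
  have [[Uc Sc] US'] := (pent_card hy, cD U US, cU U US).
  have [p qE] : exists p, q = p.+1 by exists q.-1; lia.
  have r'E : r' = (2 * p + 1)%N by lia.
  rewrite r'E in hs; have -> : (2 * q + 1 = 2 + (2 * p + 1))%N by lia.
  apply: (hull_mull (r1 := 2) US (pent_Cy hy) (IH3 _ _ _ _ _ hs)); [lia|lia|exact: orBd|].
  move=> g hg; apply: hull_gen; right; rewrite qE /=.
  have h : prod_type (2 :: 0 :: 1 :: nseq p 2)%N S (y * g).
    by exists U, y, g; split=> //; apply: pent_Cy.
  exact: prod_cons (fun _ _ => @prod_swap _ _ _ _ _) (prod_swap h).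
move=> r' S' x rE S'S c4 hx; apply: hull_trans (IHv _ _ _ _ _ hx) => [g hg||]; try lia.
by apply: hull_gen; left.
Qed.

End Generation.

(** * Torsion and elements of order 5 *)

Section Torsion.
Variable T : finType.
Implicit Types (S U W : {set T}) (y z d : chain {set T}).

(** Saturating by all positive integers amounts to working over the rationals, saturating by those
    in [coprime5] to working over the integers localized at 5. *)
Definition pos_nat : pred nat := fun m => (0 < m)%N.
Definition coprime5 : pred nat := fun m => coprime m 5.

Lemma pos_nat_mul : mul_closed pos_nat.
Proof. by split=> // m n; rewrite /pos_nat => m0 n0; rewrite muln_gt0 m0. Qed.

Lemma coprime5_mul : mul_closed coprime5.
Proof. by split=> // m n; rewrite /coprime5 coprimeMl => -> ->. Qed.

Lemma pent_pent_hull S U y z : U \subset S -> #|U| = 5%N -> #|S :\: U| = 5%N ->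
  y \in Cy U 2 -> z \in Cy (S :\: U) 2 ->
  hull pos_nat (or_Bd S 4 (fun x => exists (V : {set T}) y3 y7,
     [/\ V \subset S, is_tri V y3, y7 \in Cy (S :\: V) 3 & x = y3 * y7])) (y * z).
Proof.
move=> US U5 W5 hy hz; set H := fun x => exists V, _.
have hBd x : Bd S (2 + 2) x -> hull pos_nat (or_Bd S 4 H) x.
  by move=> h; apply: hull_gen; left.
apply: (hull_mull US hy (Cy5_hull pos_nat_mul isT W5 hz)) => // g hg.
apply: (hull_mulr US (Cy5_hull pos_nat_mul isT U5 hy) (hex_Cy hg)) => // h hh.
rewrite /H -(setU_D US); apply: hex_hex => //; exact: disjointD.
Qed.

(** Rationally the two factors [5,2] become a triangle times a cycle on seven vertices. This
    triangle and the given factor [3,1] yield a free vertex, the factor [1,0] another, and the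
    product bounds. *)
Lemma two_pent_torsion ks S z : prod_type [:: 0, 1, 2, 2 & ks]%N S z ->
  hull pos_nat (Bd S (5 + sumn ks)) z.
Proof.
move=> hz; have : prod_type [:: 2, 2, 1, 0 & ks]%N S z.
  have sw k l ls S' z' : prod_type [:: k, l & ls] S' z' -> prod_type [:: l, k & ls] S' z'.
    exact: prod_swap.
  have h1 := prod_cons (sw 1 2 (2 :: ks))%N hz.
  have h2 := prod_cons (fun S' z' => prod_cons (sw 1 2 ks)%N) (prod_swap h1).
  have h3 := prod_cons (sw 0 2 (1 :: ks))%N h2.
  exact: prod_cons (fun S' z' => prod_cons (sw 0 1 ks)%N) h3.
move=> [U [y [_ [US U5 hy [W [z' [w [WS W5 hz' hw ->]]]] ->]]]].
have {}hw : prod_type [:: 1, 0 & ks]%N (S :\: U :\: W) w := hw.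
rewrite mulrA.
have VS : U :|: W \subset S by rewrite subUset US (subset_trans WS (subsetDl _ _)).
have VU : (U :|: W) :\: U = W.
  rewrite setDUl setDv set0U; apply/setDidPl.
  by move: WS; rewrite subsetD => /andP[].
have UV : U \subset U :|: W by apply: subsetUl.
have W5' : #|(U :|: W) :\: U| = 5%N by rewrite VU.
have hz'' : z' \in Cy ((U :|: W) :\: U) 2 by rewrite VU.
have hyz := pent_pent_hull UV U5 W5' hy hz''.
move: (U :|: W) VS hyz hw {VU UV W5' hz''} (setDDl S U W) => V VS hyz hw E.
have {hw E} : prod_type [:: 1, 0 & ks]%N (S :\: V) w by rewrite -E.
move=> [U1 [y1 [w1 [U1S U13 hy1 hw1 ->]]]].
have {}hw1 : prod_type (0%N :: ks) (S :\: V :\: U1) w1 := hw1.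
have hfree := prod_free hw1.
have hr : y1 * w1 \in Cy (S :\: V) (1 + sumn ks) by apply: CyM_sub U1S hy1 (prod_Cy hw1).
have -> : (5 + sumn ks = 4 + (1 + sumn ks))%N by lia.
apply: (hull_mulr (r1 := 4) VS hyz hr) => [x hx|]; first exact: hull_gen.
move=> _ [V3 [y3 [y7 [V3S h3 h7 ->]]]].
have [V3c hy3] := (tri_card h3, tri_Cy h3).
have dV3 : [disjoint V & U1] by rewrite disjoint_sym; move: U1S; rewrite subsetD => /andP[].
have dVw : V :\: V3 \subset S :\: V3 :\: U1.
  apply/subsetP => x; rewrite !inE => /andP[xV3 xV].
  by rewrite xV3 (subsetP VS _ xV) (disjointFr dV3 xV).
have hw' : w1 \in Cy ((S :\: V3 :\: U1) :\: (V :\: V3)) (sumn ks).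
  apply: Cy_sub (prod_Cy hw1); apply/subsetP => x; rewrite !inE => /and3P[xU1 xV xS].
  by rewrite xU1 xS (negbTE xV) andbF /= andbT; apply: contra xV; apply: (subsetP V3S).
have h7w : y7 * w1 \in Cy (S :\: V3 :\: U1) (3 + sumn ks) by apply: CyM_sub dVw h7 hw'.
(* [y1], with one edge, moves past [y7], with three edges, so that the two factors [3,1] become
   adjacent. *)
have sgn : y3 * y7 * (y1 * w1) = (y3 * (y1 * (y7 * w1))) *~ (-1) ^+ 3.
  rewrite -!mulrA (mulrA y7) (ChC (Cy_Ch h7) (Cy_Ch hy1)) mulrzAl -!mulrA muln1.
  exact: mulrzAr.
rewrite sgn; apply: hullMz.
have U1S' : U1 \subset S :\: V3.
  apply/subsetP => x xU1; have := subsetP U1S _ xU1; rewrite !inE => /andP[xV ->].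
  by rewrite andbT; apply: contra xV; apply: (subsetP V3S).
apply: (tri_tri_mul_hull pos_nat_mul isT (subset_trans V3S VS) V3c hy3 U1S' U13 hy1 h7w) => x hx.
  by apply: hull_gen; congr (Bd _ _ _): hx; lia.
have VUS : V3 :|: U1 \subset S.
  by rewrite subUset (subset_trans V3S VS) (subset_trans U1S') ?subsetDl.
have h7f : free_at (S :\: (V3 :|: U1)) (3 + sumn ks) (y7 * w1).
  have [c cS hc] := hfree; rewrite -setDDl; exists c.
    move: cS; rewrite !inE => /and3P[-> cV ->]; rewrite andbT /=.
    by apply: contra cV; apply: (subsetP V3S).
  apply: CyM_sub h7 _.
    apply/subsetP => t xV; rewrite in_setD1 (subsetP dVw) // andbT.
    apply: contraTneq cS => <-; rewrite !inE !negb_and !negbK.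
    by move: xV; rewrite inE => /andP[_ ->]; rewrite orbT.
  apply: Cy_sub hc; apply/subsetP => t; rewrite !inE => /and4P[xc xU1 xV xS].
  rewrite xc xU1 xS (negbTE xV) andbF /= andbT; apply: contra xV; exact: (subsetP V3S).
have := free_mul_Bd VUS hx h7f => hB.
by apply: hull_gen; congr (Bd _ _ _): hB; lia.
Qed.

End Torsion.

(** * Finding and enlarging cycles of order 5 *)

Section OrderFive.
Variable T : finType.
Implicit Types (S U W : {set T}) (y z d : chain {set T}).

Definition order5 S r z := Bd S r (z *+ 5) /\ ~ Bd S r z.

Lemma BdN S r z : Bd S r z -> Bd S r (- z).
Proof. by rewrite -sub0r; apply: BdB; apply: Bd0. Qed.

Lemma BdMn S r z n : Bd S r z -> Bd S r (z *+ n).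
Proof.
move=> hz; elim: n => [|n IH]; first exact: Bd0.
by rewrite mulrS -[_ *+ n]opprK; apply: BdB => //; apply: BdN.
Qed.

Lemma Bd_coprime S r z m n : (0 < m)%N -> coprime m n ->
  Bd S r (z *+ m) -> Bd S r (z *+ n) -> Bd S r z.
Proof.
move=> m0 /(coprimeP _ m0)[[u v] /= uv] hm hn.
have -> : z = z *+ m *+ u - z *+ n *+ v.
  rewrite -!mulrnA -mulrnBr; last by lia.
  by rewrite [(m * u)%N]mulnC [(n * v)%N]mulnC uv.
by apply: BdB; apply: BdMn.
Qed.

(** Divide the annihilator [m] by 5 as long as the result still annihilates [z]: either it becomes
    prime to 5, or the first failure exhibits a multiple of order 5. *)
Lemma torsion_order5 S r z m : (0 < m)%N -> Bd S r (z *+ m) ->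
  (exists2 n, coprime5 n & Bd S r (z *+ n)) \/ exists k, order5 S r (z *+ k).
Proof.
have [M] := ubnP m; elim: M m => // M IH m mM m0 hm.
have [m5|] := boolP (5 %| m)%N; last first.
  by left; exists m => //; rewrite /coprime5 coprime_sym prime_coprime.
have mE : m = (m %/ 5 * 5)%N by rewrite divnK.
have [h|nh] := pselect (Bd S r (z *+ (m %/ 5))).
  by apply: (IH (m %/ 5)%N) => //; lia.
by right; exists (m %/ 5)%N; split=> //; rewrite -mulrnA -mE.
Qed.

(** If no multiple of a generator had order 5, every generator would be annihilated by an integer
    prime to 5, hence so would [z]; as 5 annihilates [z] too, it would bound. *)
Lemma hull_order5 S r (H : chain {set T} -> Prop) z :
  hull coprime5 (or_Bd S r H) z -> order5 S r z ->
  (forall g, H g -> exists2 m, (0 < m)%N & Bd S r (g *+ m)) ->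
  exists g k, H g /\ order5 S r (g *+ k).
Proof.
move=> hz [z5 nz] tors; have [//|none] := pselect (exists g k, H g /\ order5 S r (g *+ k)).
have [|||n n5 hn] := hull_elim (P := Bd S r) coprime5_mul _ _ _ hz; last 1 first.
- by case: nz; apply: (@Bd_coprime _ _ _ 5 n) => //; rewrite coprime_sym.
- exact: Bd0.
- exact: BdB.
move=> g [hg|hg]; first by exists 1%N.
have [m m0 hm] := tors _ hg.
have [//|[k hk]] := torsion_order5 m0 hm.
by case: none; exists g, k.
Qed.

Lemma hull_pos_Bd S r z : hull pos_nat (Bd S r) z -> exists2 m, (0 < m)%N & Bd S r (z *+ m).
Proof.
move=> hz; have := hull_elim (P := Bd S r) pos_nat_mul (@Bd0 _ S r) (@BdB _ S r) _ hz.
by apply=> g hg; exists 1%N.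
Qed.

Definition hex_prod ks S z := exists U h d,
  [/\ U \subset S, is_hex U h, prod_type ks (S :\: U) d & z = h * d].

Lemma hex_card U h : is_hex U h -> #|U| = 5%N.
Proof.
by move=> [s [t [us hs ht -> _]]]; rewrite cardsE (card_uniqP us) size_cat hs ht.
Qed.

Lemma hex_prod_type ks S z k : hex_prod ks S z -> prod_type (2%N :: ks) S (z *+ k).
Proof.
move=> [U [h [d [US hh hd ->]]]]; exists U, (h *+ k), d; rewrite (hex_card hh); split=> //.
  by rewrite rpredMn // hex_Cy.
by rewrite mulrnAl.
Qed.

Lemma prod_hull_hex ks S z : prod_type (2%N :: ks) S z ->
  hull coprime5 (or_Bd S (2 + sumn ks) (hex_prod ks S)) z.
Proof.
move=> [U [y [d [US U5 hy hd ->]]]].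
apply: (hull_mulr (r1 := 2) US (Cy5_hull coprime5_mul isT U5 hy) (prod_Cy hd)) => [x hx|g hg].
  by apply: hull_gen; left.
by apply: hull_gen; right; exists U, g, d.
Qed.

(** One factor [5,2] is turned into a hexagon. The torsion of the generator comes from the cofactor
    [d] alone, which still contains two factors [5,2]; the hexagon thus stays available for
    enlargement. *)
Lemma hex_prod_order5 q S z : #|S| = (5 * q.+3 + 4)%N -> z \in Cy S (2 * q.+3 + 1) ->
  order5 S (2 * q.+3 + 1) z -> exists g k, hex_prod (0 :: 1 :: nseq q.+2 2)%N S g /\
    order5 S (2 * q.+3 + 1) (g *+ k).
Proof.
move=> Sn hz o5.
have [_ _ _ h] := matching_generation coprime5_mul isT (erefl #|S|).
apply: (hull_order5 _ o5) => [|g [U [h' [d [US hh hd ->]]]]].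
  apply: hull_trans (h _ _ Sn hz) => g [hg|hg]; first by apply: hull_gen; left.
  have := prod_hull_hex (prod_swap (prod_cons (fun S' z' => @prod_swap _ 1 2 (nseq q.+2 2) S' z')%N hg)).
  apply: hull_trans => g' [hg'|hg']; last by apply: hull_gen; right.
  apply: hull_gen; left; congr (Bd _ _ _): hg'.
  by rewrite /= sumn_nseq; lia.
have td := two_pent_torsion hd.
apply: hull_pos_Bd; rewrite (_ : 2 * q.+3 + 1 = 2 + (5 + sumn (nseq q 2)))%N; last first.
  by rewrite sumn_nseq; lia.
apply: (hull_mull (r1 := 2) (r2 := (5 + sumn (nseq q 2))%N) (H := fun=> False) US (hex_Cy hh)) => [|x hx|//].
  by apply: hull_trans td => x hx; apply: hull_gen; left.
exact: hull_gen.
Qed.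

(** In the expansion along row [a], only the term of column [b] contains the corner edge [ab]. *)
Lemma link_bc_cons (a b : T) s t : uniq ((a :: s) ++ (b :: t)) ->
  link [set a; b] (bc (a :: s) (b :: t)) = bc s t.
Proof.
move=> us; have := us; rewrite /= => /andP[ast ust].
have [us' hst ubt] : [/\ uniq s, ~~ has (mem s) (b :: t) & uniq (b :: t)].
  by apply/and3P; rewrite -cat_uniq.
have link0 l : uniq l -> {subset l <= b :: t} -> link [set a; b] (bc s l) = 0.
  move=> ul hl; have usl : uniq (s ++ l).
    rewrite cat_uniq us' ul andbT; apply/hasPn => x /hl; exact: (hasPn hst).
  apply: (link_vertex _ _ (Ch_bc usl)); rewrite inE mem_cat negb_or.
  move: ast; rewrite mem_cat negb_or => /andP[-> abt] /=.
  by apply: contra abt => /hl.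
have [bt ut] : b \notin t /\ uniq t by apply/andP.
rewrite raddfB /= link_ptM eqxx link0 //; last by move=> x xt; rewrite inE xt orbT.
rewrite mulr0 subr0 (lap_map _ _ (raddfB (link [set a; b]))).
rewrite (@eq_lap _ _ _ (fun _ _ => 0)) ?lap0 ?subr0 // => x l p /=.
have xt : x \in t by rewrite -(perm_mem p) mem_head.
have lt : {subset l <= t} by move=> y yl; rewrite -(perm_mem p) inE yl orbT.
have /andP[_ ul] : uniq (x :: l) by rewrite (perm_uniq p).
rewrite link_ptM eq_edge (_ : (x == b) = false); last by apply: contraNF bt => /eqP<-.
rewrite link0 ?mulr0 ?subr0 //.
  by apply/andP; split=> //; apply: contra bt; apply: lt.
by move=> y; rewrite !inE => /orP[->//|/lt->]; rewrite orbT.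
Qed.

Lemma Bd_link S r z (a b : T) : Bd S r.+1 z -> Bd (S :\ a :\ b) r (link [set a; b] z).
Proof.
move=> [w hw <-]; rewrite -[link _ _]opprK -bd_link; apply: BdN.
by exists (link [set a; b] w) => //; apply: Ch_link.
Qed.

(** Links along the diagonal edges, pairing the new rows with the new columns, strip the chessboard
    one row and one column at a time; links send boundaries to boundaries. *)
Lemma Bd_unextend (s1 t1 s t : seq T) S W r k d m : size s1 = size t1 ->
  uniq ((s1 ++ s) ++ (t1 ++ t)) -> d \in Ch W k -> (forall a, a \in s1 -> a \notin W) ->
  Bd S (size s1 + r) ((bc (s1 ++ s) (t1 ++ t) * d) *+ m) ->
  Bd (S :\: [set x in s1 ++ t1]) r ((bc s t * d) *+ m).
Proof.
elim: s1 t1 S => [|a s1 IH] [|b t1] // S.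
  by move=> _ _ _ _; rewrite (_ : [set x in [::] ++ [::]] = set0) ?setD0.
move=> [st1] us hd aW hB.
have [ast ust] : a \notin (s1 ++ s) ++ (b :: t1 ++ t) /\ uniq ((s1 ++ s) ++ (b :: t1 ++ t)).
  by apply/andP.
have us' : uniq ((s1 ++ s) ++ (t1 ++ t)).
  by move: ust; rewrite (perm_uniq (permEl (perm_catC _ _))) /= => /andP[_];
     rewrite (perm_uniq (permEl (perm_catC _ _))).
have -> : S :\: [set x in (a :: s1) ++ (b :: t1)] = (S :\ a :\ b) :\: [set x in s1 ++ t1].
  apply/setP => x; rewrite !inE !mem_cat !inE !negb_or.
  by case: (x == a); case: (x == b); rewrite /= ?andbF ?andbT //.
apply: IH => //; first by move=> c hc; apply: aW; rewrite inE hc orbT.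
have := Bd_link a b hB; rewrite raddfMn /= linkE.
rewrite (contractionM _ _ (Ch_homogeneous (Ch_bc us))) -!linkE.
rewrite (link_vertex _ _ hd) ?aW ?mem_head // mulr0 mul0rz addr0.
by rewrite -[bc _ _]/(bc (a :: (s1 ++ s)) (b :: (t1 ++ t))) link_bc_cons.
Qed.

(** Adding equally many rows and columns keeps one extra column, so the enlarged chessboard chain is
    still a cycle. Torsion of [d] carries over to the new product, and an annihilator of the new
    product annihilates the old one. *)
Lemma extend_order5 q S g k (s1 t1 : seq T) : #|S| = (5 * q.+3 + 4)%N ->
  hex_prod (0 :: 1 :: nseq q.+2 2)%N S g -> order5 S (2 * q.+3 + 1) (g *+ k) ->
  size s1 = size t1 -> uniq (s1 ++ t1) -> (forall x, x \in s1 ++ t1 -> x \notin S) ->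
  exists2 x, x \in Cy (S :|: [set x in s1 ++ t1]) (size s1 + (2 * q.+3 + 1)) &
    order5 (S :|: [set x in s1 ++ t1]) (size s1 + (2 * q.+3 + 1)) x.
Proof.
move=> Sn [U [h [d [US hh hd ->]]]] o5 st us1 s1S; set S' := S :|: _.
have [s [t [us hs ht EU hE]]] := hh; rewrite hE in o5.
set r := (2 * q.+3 + 1)%N in o5 *.
(* The number of edges of [d]: one from [3,1] and two from each factor [5,2], two of these being
   counted in the 5. *)
pose rd := (5 + sumn (nseq q 2))%N.
have rE : r = (2 + rd)%N by rewrite /r /rd sumn_nseq; lia.
have xS x : x \in s ++ t -> x \in S by move=> xU; apply: (subsetP US); rewrite EU inE.
have pE : perm_eq ((s1 ++ s) ++ (t1 ++ t)) ((s1 ++ t1) ++ (s ++ t)).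
  by rewrite (permEl (perm_catACA _ _ _ _)).
have ub : uniq ((s1 ++ s) ++ (t1 ++ t)).
  rewrite (perm_uniq pE) cat_uniq us1 us andbT; apply/hasPn => x /xS.
  by apply: contraL => /s1S.
pose U' := [set x in (s1 ++ s) ++ (t1 ++ t)]; pose b := bc (s1 ++ s) (t1 ++ t).
have hb : b \in Cy U' (size s1 + 2).
  by rewrite -hs -size_cat; apply: Cy_bc => //; rewrite !size_cat st hs ht addnS.
have US' : U' \subset S'.
  apply/subsetP => x; rewrite inE (perm_mem pE) mem_cat in_setU [in X in _ -> X]inE.
  by move=> /orP[->|/xS ->]; rewrite ?orbT.
have sub : S :\: U \subset S' :\: U'.
  apply/subsetP => x; rewrite in_setD EU inE => /andP[xst xS1].
  rewrite in_setD inE (perm_mem pE) mem_cat negb_or xst andbT /S' in_setU xS1 andbT.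
  by apply: contraL xS1 => /s1S.
have hdS : d \in Cy (S :\: U) rd by rewrite /rd; have := prod_Cy hd.
have hx : b * d \in Cy S' (size s1 + r).
  by rewrite rE addnA; apply: CyM_sub US' hb (Cy_sub sub hdS).
have [m m0 hm] : exists2 m, (0 < m)%N & Bd S' (size s1 + r) ((b * d) *+ m).
  have [m m0 hm] := hull_pos_Bd (two_pent_torsion hd); exists m => //.
  rewrite -mulrnAr rE addnA -(setU_D US'); apply: BdMl hb _; first exact: disjointD.
  exact: Bd_sub sub hm.
have SE : S' :\: [set x in s1 ++ t1] = S.
  rewrite setDUl setDv setU0; apply/setDidPl; rewrite disjoint_subset.
  by apply/subsetP => x xS1; rewrite !inE; apply: contraL xS1 => /s1S.
have back n : Bd S' (size s1 + r) ((b * d) *+ n) -> Bd S r ((bc s t * d) *+ n).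
  move=> hB; rewrite -SE; apply: (Bd_unextend st ub (Cy_Ch hdS) _ hB) => a a1.
  by rewrite in_setD negb_and s1S ?orbT // mem_cat a1.
have hmk : Bd S' (size s1 + r) ((b * d) *+ k *+ m) by rewrite mulrnAC; apply: BdMn.
(* An annihilator [n] prime to 5 would pass back to the old cycle, which is also annihilated by 5
   and would therefore bound. *)
have [[n n5 hn]|[j hj]] := torsion_order5 m0 hmk; last first.
  by exists ((b * d) *+ k *+ j); rewrite // !rpredMn.
case: o5.2; apply: (@Bd_coprime _ _ _ 5 n) => //; first by rewrite coprime_sym.
  exact: o5.1.
by rewrite -mulrnA; apply: back; rewrite mulrnA.
Qed.

End OrderFive.

(** * Relabelling vertices *)

Section Relabelling.
Variables (T T' : finType) (f : T -> T').
Implicit Types (S : {set T}) (e : {set T}) (c : chain {set T}).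

Definition push : chain {set T} -> chain {set T'} :=
  ext (fun s => osimplex [seq f @: (e : {set T}) | e <- s]).

HB.instance Definition _ := GRing.isZmodMorphism.Build (chain {set T}) (chain {set T'})
  push (ext_is_zmod_morphism _).

Lemma push_osimplex (s : seq {set T}) :
  push (osimplex s) = osimplex [seq f @: (e : {set T}) | e <- s].
Proof. by apply: ext_osimplex => s1 x y s2; rewrite !map_cat /= osimplex_alt. Qed.

Lemma bd_push c : bd (push c) = push (bd c).
Proof.
apply: (eq_zmod_morphism (f := fun c => bd (push c)) (g := fun c => push (bd c))) c.
- by move=> c c'; rewrite !raddfB.
- by move=> c c'; rewrite !raddfB.
have pushM e c : push (pt e * c) = pt (f @: e) * push c.
  apply: (eq_zmod_morphism (f := fun c => push (pt e * c))
    (g := fun c => pt (f @: e) * push c)) c => [c c'|c c'|s _].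
  - by rewrite mulrBr raddfB.
  - by rewrite raddfB mulrBr.
  by rewrite -osimplex_cons !push_osimplex /= osimplex_cons.
move=> s _; elim: s => [|e s IH].
  by rewrite push_osimplex /= !osimplex0 !bd1 raddf0.
by rewrite osimplex_cons pushM !bd_ptM IH raddfB /= pushM.
Qed.

Lemma Ch_push S r c : {in S &, injective f} -> c \in Ch S r -> push c \in Ch (f @: S) r.
Proof.
move=> fI; apply: (Ch_additive (f := push)) => [|A /matchingP[tA hA] Ar]; first exact: raddfB.
rewrite push_osimplex; apply/ChP => B; rewrite osimplex_val.
case: ifP => // /andP[us /eqP->] _.
have EB : [set x in [seq f @: (e : {set T}) | e <- enum A]] = [set f @: (e : {set T}) | e in A].
  apply/setP => x; rewrite inE; apply/mapP/imsetP => -[e he ->]; exists e => //.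
    by rewrite mem_enum in he.
  by rewrite mem_enum.
rewrite EB; split; last first.
  by rewrite -Ar -EB cardsE (card_uniqP us) size_map -cardE.
apply/matchingP; split=> [|_ /imsetP[e /hA[e2 eS] ->]]; last first.
  split; last exact: imsetS.
  by rewrite card_in_imset // => x y /(subsetP eS) xS /(subsetP eS); apply: fI.
apply/trivIsetP => _ _ /imsetP[e eA ->] /imsetP[e' eA' ->] ne.
have nee : e != e' by apply: contraNneq ne => ->.
have := trivIsetP tA _ _ eA eA' nee; rewrite !disjoint_subset => /subsetP d.
apply/subsetP => _ /imsetP[x xe ->]; rewrite inE; apply/negP => /imsetP[y ye'].
have [[_ /subsetP eS] [_ /subsetP eS']] := (hA _ eA, hA _ eA').
move/(fI _ _ (eS _ xe) (eS' _ ye')) => E; have := d _ xe; by rewrite inE E ye'.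
Qed.

Lemma Cy_push S r c : {in S &, injective f} -> c \in Cy S r -> push c \in Cy (f @: S) r.
Proof.
by move=> fI /CyP[h1 h2]; apply/CyP; rewrite bd_push h2 raddf0; split=> //; apply: Ch_push.
Qed.

Lemma Bd_push S r c : {in S &, injective f} -> Bd S r c -> Bd (f @: S) r (push c).
Proof. by move=> fI [w hw <-]; exists (push w); [apply: Ch_push|rewrite bd_push]. Qed.

End Relabelling.

Lemma pushK (T T' : finType) (f : T -> T') (g : T' -> T) : cancel f g ->
  cancel (push f) (push g).
Proof.
move=> fK; apply: (eq_zmod_morphism (f := fun c => push g (push f c)) (g := id)) => //.
  by move=> c c'; rewrite !raddfB.
move=> s _; rewrite !push_osimplex -map_comp map_id_in // => e _ /=.
by rewrite -imset_comp (eq_imset (g := id)) ?imset_id.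
Qed.

(** * Homology classes of order 5 in terms of chains *)

Section HomologyOrder.
Variables (T : finType) (S : {set T}) (r : nat).
Let K := matching_complex S.

Lemma is_boundary_Bd (z : cycles K (r%:Z - 1)) :
  reflect (Bd S r (cycle_val z)) (z \in @is_boundary _ K (r%:Z - 1)).
Proof.
have -> : (z \in @is_boundary _ K (r%:Z - 1)) =
    `[< exists2 c, c \in in_degree K (r%:Z - 1 + 1) & boundary c = cycle_val z >] by [].
have -> : r%:Z - 1 + 1 = r.+1%:Z - 1 by lia.
apply: (iffP (asboolP _)) => -[c hc hz]; exists c => //; first by rewrite -boundaryE.
by rewrite boundaryE.
Qed.

Lemma homology_classMn (z : cycles K (r%:Z - 1)) n :
  homology_class z *+ n = homology_class (z *+ n).
Proof. by rewrite /homology_class raddfMn. Qed.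

Lemma homology_class_eq0 (z : cycles K (r%:Z - 1)) :
  (homology_class z == 0) = (z \in @is_boundary _ K (r%:Z - 1)).
Proof.
rewrite -[z in RHS]subr0 Quotient.idealrBE; congr (_ == _).
by rewrite raddf0.
Qed.

(** Since 5 is prime, a smaller positive annihilator would be coprime to 5 and make the class zero;
    hence the two conditions of [order5] suffice. *)
Lemma has_order5P (z : cycles K (r%:Z - 1)) :
  has_order (homology_class z) 5 <-> order5 S r (cycle_val z).
Proof.
have valMn n : cycle_val (z *+ n) = cycle_val z *+ n by exact: (raddfMn (val : cycles K _ -> _)).
have eq0 n : (homology_class z *+ n == 0) <-> Bd S r (cycle_val z *+ n).
  rewrite homology_classMn homology_class_eq0 -valMn.
  by split => /is_boundary_Bd.
split=> [[_ /eqP/eq0 h5 hk]|[h5 h1]].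
  split=> // h1; have := hk 1%N isT; rewrite -(mulr1n (cycle_val z)) in h1.
  by move/eq0: h1 => ->.
split=> //; first exact/eqP/eq0.
move=> k /andP[k0 k5]; apply/negP => /eq0 hk; apply: h1.
apply: (@Bd_coprime _ _ _ _ k 5) => //.
by rewrite coprime_sym prime_coprime // gtnNdvd.
Qed.

Lemma homology_order5P :
  (exists x : homology K (r%:Z - 1), has_order x 5) <->
  exists2 z, z \in Cy S r & order5 S r z.
Proof.
split=> [[x]|[z hz o5]].
  rewrite -[x]reprK -/(homology_class _) => /has_order5P o5.
  by exists (cycle_val (repr x)); first exact: valP.
by exists (homology_class (Cycle hz)); apply/has_order5P.
Qed.

End HomologyOrder.

Lemma prod_has_type n (ts : seq (nat * nat)) (z : chain {set 'I_n}) :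
  all (fun t => t.1 == t.2.*2.+1) ts -> prod_type (map snd ts) [set: 'I_n] z ->
  has_type ts z.
Proof.
move=> hts hz; split.
  by have := prod_Cy hz; rewrite sumnE big_map.
(* Families indexed by natural numbers instead of ordinals below [size ts] allow the induction on
   [ts] to shift indices freely. *)
suff h S : prod_type (map snd ts) S z ->
   exists (Sf : nat -> {set 'I_n}) (y : nat -> chain {set 'I_n}),
    [/\ \bigcup_(j < size ts) Sf j = S,
        forall j k, (j < size ts)%N -> (k < size ts)%N -> j != k -> [disjoint Sf j & Sf k],
        forall j, (j < size ts)%N -> #|Sf j| = (nth (0, 0)%N ts j).1,
        forall j, (j < size ts)%N -> y j \in Cy (Sf j) (nth (0, 0)%N ts j).2
      & z = \big[@wedge _/osimplex [::]]_(j < size ts) y j].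
  have [Sf [y [h1 h2 h3 h4 h5]]] := h _ hz.
  exists (fun j => Sf j), (fun j => y j); split=> // j; first by move=> k njk; apply: h2 => //; exact: ltn_ord.
    by rewrite h3 // (tnth_nth (0, 0)%N).
  by rewrite (tnth_nth (0, 0)%N); apply: h4.
elim: ts z S hts {hz} => [|[n0 k] ts IH] z S /=.
  move=> _ [-> ->]; exists (fun=> set0), (fun=> 0); split=> //; by rewrite ?big_ord0.
move=> /andP[/eqP /= -> hts] [U [y0 [z' [US Uk hy /(IH _ _ hts) [Sf [y [h1 h2 h3 h4 h5]]] ->]]]].
exists (fun j => if j is j'.+1 then Sf j' else U), (fun j => if j is j'.+1 then y j' else y0).
have dU j : (j < size ts)%N -> [disjoint U & Sf j].
  move=> hj; apply: disjointWr (disjointD U S); rewrite -h1.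
  exact: (bigcup_sup (Ordinal hj)).
split.
- by rewrite big_ord_recl h1 setU_D.
- move=> [|j] [|l] //= hj hl njl; first exact: dU.
    by rewrite disjoint_sym; apply: dU.
  exact: h2.
- by case=> [|j] //= hj; apply: h3.
- by case=> [|j] //= hj; apply: h4.
by rewrite big_ord_recl /= -h5 mul_wedge.
Qed.

Unset Implicit Arguments.

Theorem theorem5p10 (q : nat) (hq : (3 <= q)%N) :
  ((exists x : homology (matching_complexn (5 * q + 4)) (2 * q)%N%:Z, has_order x 5)
   <->
   (exists gamma : cycles (matching_complexn (5 * q + 4)) (2 * q)%N%:Z,
      has_type ([:: (1, 0); (3, 1)] ++ nseq q (5, 2))%N gamma /\
      has_order (homology_class gamma) 5))
  /\
  ((exists x : homology (matching_complexn (5 * q + 4)) (2 * q)%N%:Z, has_order x 5) ->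
   forall u : nat,
     exists x : homology (matching_complexn (5 * q + 4 + 2 * u)) (2 * q + u)%N%:Z,
       has_order x 5).
Proof.
have [p qE] : exists p, q = p.+3 by exists (q - 3)%N; lia.
subst q; have -> : (2 * p.+3)%N%:Z = (2 * p.+3 + 1)%N%:Z - 1 by lia.
have hS : #|[set: 'I_(5 * p.+3 + 4)]| = (5 * p.+3 + 4)%N by rewrite cardsT card_ord.
split; first split.
- move=> /homology_order5P[z hz o5].
  have [g [k [hg o5g]]] := hex_prod_order5 hS hz o5.
  have hgk := hex_prod_type k hg.
  have ht : has_type ([:: (1, 0); (3, 1)] ++ nseq p.+3 (5, 2))%N (g *+ k).
    apply: prod_has_type; first by rewrite /= all_nseq orbT.
    rewrite /= map_nseq; have := prod_swap hgk.
    exact: prod_cons (fun S' z' => @prod_swap _ 2 1 _ S' z')%N.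
  have hc : g *+ k \in Cy [set: 'I_(5 * p.+3 + 4)] (2 * p.+3 + 1).
    by have := prod_Cy hgk; rewrite /= sumn_nseq; congr (_ \in Cy _ _); lia.
  by exists (Cycle hc); split=> //; apply/has_order5P.
- by move=> [gamma [_ o5]]; exists (homology_class gamma).
move=> /homology_order5P[z hz o5] u.
set n := (5 * p.+3 + 4)%N in hS z hz o5 *.
have -> : (2 * p.+3 + u)%N%:Z = (u + (2 * p.+3 + 1))%N%:Z - 1 by lia.
apply/homology_order5P.
pose f : 'I_n -> 'I_(n + 2 * u) := lshift (2 * u).
have n0 : (0 < n)%N by rewrite /n; lia.
(* A left inverse of [f], with a default value on the new vertices; pushing back along it shows that
   the image of [z] in the larger vertex set does not bound on the image of [f]. *)
pose g (x : 'I_(n + 2 * u)) : 'I_n := if split x is inl y then y else Ordinal n0.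
have fK : cancel f g.
  by move=> x; rewrite /g /f -[lshift _ _]/(unsplit (inl x)) unsplitK.
have fI : injective f := can_inj fK.
pose S := f @: [set: 'I_n].
have Sn : #|S| = n by rewrite card_imset.
have hz' : push f z \in Cy S (2 * p.+3 + 1) by apply: Cy_push hz => x y _ _; apply: fI.
have o5' : order5 S (2 * p.+3 + 1) (push f z).
  split; first by rewrite -raddfMn; apply: Bd_push o5.1 => x y _ _; apply: fI.
  move=> h; apply: o5.2; rewrite -(pushK fK z).
  apply: Bd_sub (Bd_push _ h); first exact: subsetT.
  by move=> _ _ /imsetP[x _ ->] /imsetP[y _ ->]; rewrite !fK => ->.
have [g' [k [hg o5g]]] := hex_prod_order5 Sn hz' o5'.
(* The [2 * u] new vertices: the first half become rows and the second half columns of the enlarged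
   chessboard. *)
pose L := [seq rshift n i | i <- enum 'I_(2 * u)].
have Lu : size (take u L) = u.
  by rewrite size_takel // size_map size_enum_ord; lia.
have [|||x hx o5x] := extend_order5 Sn hg o5g (s1 := take u L) (t1 := drop u L).
- by rewrite Lu size_drop size_map size_enum_ord; lia.
- by rewrite cat_take_drop map_inj_uniq ?enum_uniq //; apply: rshift_inj.
- rewrite cat_take_drop => _ /mapP[i _ ->]; apply/negP => /imsetP[j _ /eqP].
  by rewrite eq_rlshift.
rewrite Lu in hx o5x.
have E : S :|: [set x in take u L ++ drop u L] = [set: 'I_(n + 2 * u)].
  apply/setP => y; rewrite !inE cat_take_drop; case: (splitP y) => j Ej.
    by apply/orP; left; apply/imsetP; exists j => //; apply: val_inj.
  by apply/orP; right; apply/mapP; exists j; rewrite ?mem_enum //; apply: val_inj.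
by rewrite E in hx o5x; exists x.
Qed.
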